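(* Let $\Lambda$ be the lotus of a finite active constellation of crosses $\hat{\mathcal{C}}$ above $O$, with initial vertex $L$. Then the pairs $(\lambda(E), \mathrm{ord}_E(L))$ associated to the vertices $E$ of $\Lambda$ (log-discrepancy of $E$, order of vanishing of $L$ along $E$) may be computed recursively by the following algorithm: - The pair associated to the initial vertex $L$ is equal to $(1,1)$. - The pair associated to every other base vertex is equal to $(1,0)$. - Following increasingly the partial order on the set of lateral vertices $\{E_P : P \text{ active}\}$ of $\Lambda$ induced by the partial order $\preceq$ on the active points $P$, associate to each lateral vertex the vector sum of the pairs associated to the two vertices of the unique petal base opposite to it.
   Context: **Infinitely near points and crosses.** $(S,O)$ is a germ of smooth complex analytic surface. A model is a composition of finitely many blowups of points above $O$. An infinitely near point of $O$ is $O$ or a point of the exceptional divisor of a model, points on two models being identified if the natural bimeromorphic map is a biholomorphism near them; $S^P$ is the minimal model containing $P$, and $E_P$ is the exceptional curve created by blowing up $P$ (also denoting its strict transforms). $P\preceq Q$ means that $Q$ is infinitely near $P$; then there is a morphism $\pi^Q_P:S^Q\to S^P$. A constellation is a set $\mathcal{C}$ of infinitely near points such that $Q\in\mathcal{C}$, $P\preceq Q$ imply $P\in\mathcal{C}$; it is active if one has chosen a subset of active points containing all non-maximal points; the others are inactive. A cross at $P$ is a reduced germ of normal crossings divisor with two branches at $P$. A constellation of crosses $\hat{\mathcal{C}}$ is a constellation $\mathcal{C}$ with a cross $X_P$ on $(S^P,P)$ for each $P\in\mathcal{C}$, such that the germ at $Q$ of $(\pi^Q_P)^{-1}(X_P)$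 is contained in $X_Q$ whenever $P\preceq Q$. **Lotus.** The dual segment of a cross is a segment with vertices labeled by its two branches. The lotus $\Lambda$ of $\hat{\mathcal{C}}$ is the simplicial complex built by starting from the dual segment of $X_O=L+L_1$ ($L$ being the initial vertex) and going through the points of $\mathcal{C}$ in an order compatible with $\preceq$: (A) when $P$ is active, glue a triangle (petal) with vertices the branches of $X_P$ and $E_P$ along the dual segment of $X_P$ (its base, opposite to the vertex $E_P$), identifying vertices with the same label; (B) for a point $Q\neq O$, if the germ at $Q$ of the current total transform is a cross, this is $X_Q$, whose dual segment is already present; otherwise $X_Q=E+L_Q$ with $E$ the germ of the exceptional divisor and $L_Q$ smooth transversal to it (a curvetta), and one glues the dual segment of $X_Q$ at the vertex $E$. Base vertices: $L$, $L_1$ and all $L_Q$; lateral vertices: all $E_P$, $P$ active. **Invariants.** For a curve germ $C$ on a model $\pi:S_\pi\to S$ (an irreducible exceptional curve, or the strict transform of a branch on $(S,O)$), $\mathrm{ord}_C(L)$ is the order of vanishing along $C$ of $\pi^*f_L$, where $f_L$ is a defining function of $L$; the log-discrepancy is $\lambda(C):=1+\mathrm{ord}_C(\mathrm{div}(\pi^*\omega))$ with $\omega$ a non-vanishing germ of holomorphic $2$-form on $(S,O)$. *)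

(* Defs.v *)
From HB Require Import structures.
From mathcomp Require Import all_boot all_order all_algebra.
From mathcomp Require Import finmap complex.
From mathcomp Require Import all_classical all_reals all_analysis.
Set Implicit Arguments.
Unset Strict Implicit.
Unset Printing Implicit Defensive.
Import Order.TTheory GRing.Theory Num.Theory.
Import numFieldNormedType.Exports.
Local Open Scope classical_set_scope.
Local Open Scope ring_scope.

(* A smooth germ of surface is handled through local coordinates, i.e. as
   (C^2, 0). A germ of holomorphic function is represented by a function on
   C^2 of which only the values near 0 matter. *)

Definition Cx (R : realType) : numFieldType := R[i].

Definition C2 (R : realType) : normedModType (Cx R) := (Cx R * Cx R)%type.

Definition fgerm (R : realType) := C2 R -> Cx R.

(* Membership in C{x,y}. The growth condition makes the double series
   absolutely convergent on a polydisc, so that summing it by squares is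
   harmless. *)
Definition analytic (R : realType) (f : fgerm R) : Prop :=
  exists (a : nat -> nat -> Cx R) (M r : Cx R),
    [/\ 0 < r,
        forall i j, `|a i j| * r ^+ (i + j) <= M
      & \forall z \near (0 : C2 R),
          (fun n : nat =>
             \sum_(i < n) \sum_(j < n) a i j * z.1 ^+ i * z.2 ^+ j)
            @ \oo --> f z].

Definition divides (R : realType) (h f : fgerm R) : Prop :=
  exists2 g : fgerm R, analytic g & \forall z \near (0 : C2 R), f z = h z * g z.

(* k is the order of vanishing of f along the irreducible germ {h = 0}. *)
Definition vanishing_order (R : realType) (h f : fgerm R) (k : nat) : Prop :=
  divides (fun z => h z ^+ k) f /\ ~ divides (fun z => h z ^+ k.+1) f.

Definition germ_sub (R : realType) (A B : set (C2 R)) : Prop :=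
  \forall z \near (0 : C2 R), A z -> B z.

Definition zeros (R : realType) (f : fgerm R) : set (C2 R) :=
  [set z | f z = 0].

Definition jac (R : realType) (F : C2 R -> C2 R) (z : C2 R) : Cx R :=
  'D_((1, 0) : C2 R) (fun p => (F p).1) z *
  'D_((0, 1) : C2 R) (fun p => (F p).2) z -
  'D_((0, 1) : C2 R) (fun p => (F p).1) z *
  'D_((1, 0) : C2 R) (fun p => (F p).2) z.

(* Equations of the two branches of a reduced normal crossings germ. *)
Definition cross (R : realType) (x : fgerm R * fgerm R) : Prop :=
  [/\ analytic x.1 /\ analytic x.2,
      x.1 0 = 0 /\ x.2 0 = 0
    & jac (fun z => (x.1 z, x.2 z)) 0 != 0].

Definition cross_set (R : realType) (x : fgerm R * fgerm R) : set (C2 R) :=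
  zeros x.1 `|` zeros x.2.

(* An infinitely near point is encoded by the successive directions chosen on
   the exceptional curves: the empty sequence is O and [rcons P d] is the point
   of E_P, identified with the projective line of tangent directions at P, of
   slope t when d = Some t and vertical when d = None. The blowups of the
   proper prefixes of P give the minimal model S^P, and P comes with the local
   coordinates of S^P centred at it that are obtained from those of (S, O) by
   the charts below. *)
Definition inf_near (R : realType) := seq (option (Cx R)).

(* The relation "Q is infinitely near P" is [prefix P Q]. *)

(* The blowup of the origin near the point d of the exceptional curve. *)
Definition chart (R : realType) (d : option (Cx R)) (z : C2 R) : C2 R :=
  if d is Some t then (z.1, z.1 * (z.2 + t)) else (z.1 * z.2, z.2).

(* Equation of the exceptional curve in that chart. *)
Definition exc_eq (R : realType) (d : option (Cx R)) (z : C2 R) : Cx R :=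
  if d is Some _ then z.1 else z.2.

(* The morphism from S^(P ++ s) to S^P, near the point P ++ s. *)
Fixpoint blowdown (R : realType) (s : inf_near R) (z : C2 R) : C2 R :=
  if s is d :: s' then chart d (blowdown s' z) else z.

(* The morphism pi_P^Q, for P a prefix of Q. *)
Definition proj (R : realType) (P Q : inf_near R) : C2 R -> C2 R :=
  blowdown (drop (size P) Q).

(* [branches P] gives equations of the two branches of X_P; at O they are
   L and L_1, in that order. *)
Record constellation (R : realType) := Constellation {
  points : {fset inf_near R};
  active : {fset inf_near R};
  branches : inf_near R -> fgerm R * fgerm R;
  origin_in : [::] \in points;
  points_closed : forall P Q, Q \in points -> prefix P Q -> P \in points;
  active_sub : forall P, P \in active -> P \in points;
  active_nonmax : forall P Q,
    P \in points -> Q \in points -> prefix P Q -> P != Q -> P \in active;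
  branchesP : forall P, P \in points -> cross (branches P);
  branches_compat : forall P Q, P \in points -> Q \in points -> prefix P Q ->
    germ_sub (proj P Q @^-1` cross_set (branches P)) (cross_set (branches Q))
}.

(* Names of the curves that may label the vertices: L, L_1, L_Q and E_P. *)
Inductive label (R : realType) :=
  | Initial
  | Second
  | Curvetta of inf_near R
  | Lateral of inf_near R.
Arguments Initial {R}.
Arguments Second {R}.

(* The germ at Q of the total transform of the crosses at the points strictly
   below Q. *)
Definition total_transform (R : realType) (K : constellation R) (Q : inf_near R) :
    set (C2 R) :=
  [set z | exists P, [/\ prefix P Q, P != Q
                       & cross_set (branches K P) (proj P Q z)]].

Definition is_cross (R : realType) (A : set (C2 R)) : Prop :=
  exists x, [/\ cross x, germ_sub A (cross_set x) & germ_sub (cross_set x) A].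

Definition needs_curvetta (R : realType) (K : constellation R) (Q : inf_near R) :
    Prop :=
  [/\ Q \in points K, Q != [::] & ~ is_cross (total_transform K Q)].

(* h is an equation, at the point Q, of the curve named v on the model where
   that curve first appears: S for L and L_1, S^Q for L_Q, and the blowup of
   P in S^P, at any point of the exceptional curve, for E_P. *)
Inductive curve_germ (R : realType) (K : constellation R) :
    label R -> inf_near R -> fgerm R -> Prop :=
  | curve_initial : curve_germ K Initial [::] (branches K [::]).1
  | curve_second : curve_germ K Second [::] (branches K [::]).2
  | curve_curvetta Q h :
      needs_curvetta K Q ->
      h = (branches K Q).1 \/ h = (branches K Q).2 ->
      ~ germ_sub (zeros h) [set z | proj [::] Q z = 0] ->
      curve_germ K (Curvetta Q) Q h
  | curve_lateral P d : curve_germ K (Lateral P) (rcons P d) (exc_eq d).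

(* The branch {h = 0} at P lies on the strict transform of the curve named v:
   it maps into that curve and is not contracted. *)
Definition has_label (R : realType) (K : constellation R)
    (P : inf_near R) (h : fgerm R) (v : label R) : Prop :=
  exists Q g, [/\ curve_germ K v Q g, prefix Q P,
    germ_sub (zeros h) (proj Q P @^-1` zeros g)
  & ~ germ_sub (zeros h) [set z | proj Q P z = 0]].

(* The pair b of end points of the dual segment of X_P. *)
Definition dual_segment (R : realType) (K : constellation R)
    (P : inf_near R) (b : label R * label R) : Prop :=
  has_label K P (branches K P).1 b.1 /\ has_label K P (branches K P).2 b.2.

(* b is the base of a petal whose opposite vertex is E_P. *)
Definition petal_base (R : realType) (K : constellation R)
    (P : inf_near R) (b : label R * label R) : Prop :=
  P \in active K /\ dual_segment K P b.

(* The simplices of the lotus, as sets of labels. Since equal labels are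
   identified, each gluing is a union, and the order in which the points are
   visited plays no role. *)
Inductive lotus (R : realType) (K : constellation R) : set (label R) -> Prop :=
  | lotus_start b : dual_segment K [::] b -> lotus K [set b.1; b.2]
  | lotus_petal P b :
      petal_base K P b -> lotus K [set b.1; b.2; Lateral P]
  | lotus_segment Q b :
      needs_curvetta K Q -> dual_segment K Q b -> lotus K [set b.1; b.2]
  | lotus_face s t : lotus K s -> t `<=` s -> t !=set0 -> lotus K t.

Definition lotus_vertex (R : realType) (K : constellation R) (v : label R) :=
  lotus K [set v].

Definition base_vertex (R : realType) (K : constellation R) (v : label R) :
    Prop :=
  match v with
  | Initial | Second => True
  | Curvetta Q => needs_curvetta K Q
  | Lateral _ => False
  end.

(* (lambda, ord(L)) for the curve germ {h = 0} at Q, the 2-form being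
   omega = w dx /\ dy, so that its pullback is (w o pi) jac(pi) du /\ dv. *)
Definition germ_pair (R : realType) (K : constellation R) (w : fgerm R)
    (Q : inf_near R) (h : fgerm R) (p : nat * nat) : Prop :=
  (exists2 k, p.1 = k.+1 &
     vanishing_order h
       (fun z => w (proj [::] Q z) * jac (proj [::] Q) z) k) /\
  vanishing_order h (fun z => (branches K [::]).1 (proj [::] Q z)) p.2.

Definition curve_pair (R : realType) (K : constellation R) (w : fgerm R)
    (v : label R) (p : nat * nat) : Prop :=
  forall Q h, curve_germ K v Q h -> germ_pair K w Q h p.

(* The partial assignment of pairs to vertices maintained by the algorithm. *)
Definition assignment (R : realType) := label R -> option (nat * nat).

Definition initial_assignment (R : realType) (K : constellation R)
    (t : assignment R) : Prop :=
  [/\ t Initial = Some (1, 1)%N,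
      forall v, base_vertex K v -> v <> Initial -> t v = Some (1, 0)%N
    & forall v, ~ base_vertex K v -> t v = None].

(* [run K ps t]: having treated the lateral vertices E_P for P in ps, from
   left to right, the algorithm is in state t. *)
Inductive run (R : realType) (K : constellation R) :
    seq (inf_near R) -> assignment R -> Prop :=
  | run_start t : initial_assignment K t -> run K [::] t
  | run_step ps P b p q t t' :
      run K ps t ->
      unique (petal_base K P) b ->
      t b.1 = Some p -> t b.2 = Some q ->
      t' (Lateral P) = Some (p.1 + q.1, p.2 + q.2)%N ->
      (forall v, v <> Lateral P -> t' v = t v) ->
      run K (rcons ps P) t'.

(* ps lists the active points in an order compatible with [prefix]. *)
Definition increasing_listing (R : realType) (K : constellation R)
    (ps : seq (inf_near R)) : Prop :=
  [/\ uniq ps, ps =i active K & pairwise (fun P Q => ~~ prefix Q P) ps].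

(* Main.v *)
(* At a point P of the constellation, the pullbacks of the 2-form and of the
   equation of L are monomials, up to units, in equations u1, u2 of the two
   branches of X_P, the exponents being read off from the pairs of their labels.
   The order along E_P is the multiplicity at P, that is the sum of the two
   exponents (plus one for the 2-form, since a chart has Jacobian e, the
   equation of E_P): this is the vector sum of the algorithm. At a point of E_P
   the two curves to consider are e and the strict transform of u1 or u2 if one
   of them passes through it, and otherwise e and a curvetta, along which both
   exponents vanish, so the monomial form propagates.
   The only analysis needed is that a smooth germ transversal to E_P is a graph
   over a coordinate line, by a contraction argument, so that an inclusion
   between two such germs is an equality. That distinct labels name distinct
   curves follows by looking at what the projections to lower points contract. *)
Require Import Defs.
From HB Require Import structures.
From mathcomp Require Import all_boot all_order all_algebra.
From mathcomp Require Import finmap complex.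
From mathcomp Require Import all_classical all_reals all_analysis.
From mathcomp Require Import ring lra zify.
Import Order.TTheory GRing.Theory Num.Theory.
Import numFieldNormedType.Exports.
Import Normc.
Local Open Scope classical_set_scope.
Local Open Scope ring_scope.
Set Implicit Arguments.
Unset Strict Implicit.
Unset Printing Implicit Defensive.
Local Notation proj := Defs.proj.

(** * The modulus of a complex number, with real values *)

(** No factorisation in the ring of convergent series is used: two equations of the same branch are
    never shown to differ by a unit. Branches, labels and crosses are therefore compared as germs of
    sets, and the monomial forms are written in equations carried along by the blowups, which may
    differ from those of [branches]. Orders of vanishing are needed in three elementary situations
    only: along the exceptional curve, whose equation is a coordinate and can be cancelled outside
    its zeros; along a curve on which the function does not vanish identically, which gives order 0;
    and for L along itself. Apart from closure of power series under products, charts and division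
    by a coordinate, only the first-order part of a germ matters. It is taken in the sense of strict
    differentiability, which controls differences f(z) - f(z') near 0, as contraction and uniqueness
    arguments require. *)

Definition cnorm (R : realType) (z : Cx R) : R := normc (z : R[i]).
#[global] Arguments cnorm {R} z : simpl never.

Section Modulus.
Variable R : realType.
Implicit Types z x y : Cx R.

Lemma norm_cnorm z : `|z| = ((cnorm z)%:C)%C.
Proof. by []. Qed.

Lemma cnorm_ge0 z : 0 <= cnorm z.
Proof. by have := normr_ge0 z; rewrite norm_cnorm ler0c. Qed.

Lemma cnormD x y : cnorm (x + y) <= cnorm x + cnorm y.
Proof. exact: le_normcD. Qed.

Lemma cnormM x y : cnorm (x * y) = cnorm x * cnorm y.
Proof. exact: normcM. Qed.

Lemma cnormN x : cnorm (- x) = cnorm x.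
Proof. exact: normcN. Qed.

Lemma cnorm0 : cnorm (0 : Cx R) = 0.
Proof. exact: normc0. Qed.

Lemma cnorm1 : cnorm (1 : Cx R) = 1.
Proof. exact: normc1. Qed.

Lemma cnorm_eq0 x : (cnorm x == 0) = (x == 0).
Proof.
apply/eqP/eqP => [/eq0_normc //|->]; exact: cnorm0.
Qed.

Lemma cnorm_gt0 x : (0 < cnorm x) = (x != 0).
Proof. by rewrite lt_def cnorm_eq0 cnorm_ge0 andbT. Qed.

Lemma cnormV x : cnorm x^-1 = (cnorm x)^-1.
Proof. exact: normcV. Qed.

Lemma cnormX x n : cnorm (x ^+ n) = cnorm x ^+ n.
Proof.
by elim: n => [|n IH]; rewrite ?expr0 ?cnorm1 // !exprS cnormM IH.
Qed.

Lemma cnormB x y : cnorm (x - y) <= cnorm x + cnorm y.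
Proof. by rewrite -(cnormN y); exact: cnormD. Qed.

Lemma cnorm_distC x y : cnorm (x - y) = cnorm (y - x).
Proof. by rewrite -cnormN opprB. Qed.

Lemma cnorm_real (r : R) : 0 <= r -> cnorm ((r%:C)%C : Cx R) = r.
Proof. by move=> r0; rewrite /cnorm /= expr0n /= addr0 sqrtr_sqr ger0_norm. Qed.

Lemma cnorm_sum (I : Type) (s : seq I) (P : pred I) (F : I -> Cx R) :
  cnorm (\sum_(i <- s | P i) F i) <= \sum_(i <- s | P i) cnorm (F i).
Proof.
elim: s => [|i s IH]; first by rewrite !big_nil cnorm0.
rewrite !big_cons; case: ifP => _ //.
by apply: le_trans (cnormD _ _) _; rewrite lerD2l.
Qed.

Lemma normr_Re_le z : `|complex.Re (z : R[i])| <= cnorm z.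
Proof.
case: z => a b /=; rewrite /cnorm /= -sqrtr_sqr ler_wsqrtr //.
by rewrite lerDl sqr_ge0.
Qed.

Lemma normr_Im_le z : `|complex.Im (z : R[i])| <= cnorm z.
Proof.
case: z => a b /=; rewrite /cnorm /= -sqrtr_sqr ler_wsqrtr //.
by rewrite lerDr sqr_ge0.
Qed.

Lemma cnorm_le_ReIm z :
  cnorm z <= `|complex.Re (z : R[i])| + `|complex.Im (z : R[i])|.
Proof.
case: z => a b /=; rewrite /cnorm /= -[leRHS]ger0_norm ?addr_ge0 //.
rewrite -sqrtr_sqr ler_wsqrtr // sqrrD !real_normK ?num_real //.
by rewrite addrAC lerDl mulrn_wge0 // mulr_ge0.
Qed.

Lemma Cx_gt0P (e : Cx R) : 0 < e -> exists2 r : R, 0 < r & e = (r%:C)%C.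
Proof.
case: e => a b; rewrite ltcE /= => /andP[/eqP b0 a0]; exists a => //; rewrite b0; reflexivity.
Qed.

(** Neighbourhoods of the origin become polydiscs of real radius: the order of [Cx R] is only
    partial, whereas real radii can be compared, minimised and passed to [lra]. *)
Lemma near_C2P (P : C2 R -> Prop) :
  (\forall z \near (0 : C2 R), P z) <->
  exists2 d : R, 0 < d & forall z : C2 R, cnorm z.1 < d -> cnorm z.2 < d -> P z.
Proof.
split.
  case=> -[A B] /= [hA hB] AB.
  have /nbhs_norm0P[e1 /= e10 A1] : nbhs (0 : Cx R) A by exact: hA.
  have /nbhs_norm0P[e2 /= e20 B1] : nbhs (0 : Cx R) B by exact: hB.
  have [r1 r10 E1] := Cx_gt0P e10; have [r2 r20 E2] := Cx_gt0P e20.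
  exists (Num.min r1 r2); first by rewrite lt_min r10.
  move=> [x y] /=; rewrite !lt_min => /andP[x1 _] /andP[_ y2].
  apply: AB; split => /=.
    by apply: A1; rewrite /= norm_cnorm E1 ltcR.
  by apply: B1; rewrite /= norm_cnorm E2 ltcR.
case=> d d0 H.
have dC : (0 : Cx R) < (d%:C)%C by rewrite ltcR.
exists ([set x | `|x| < (d%:C)%C], [set x | `|x| < (d%:C)%C]) => /=.
  have nd : nbhs (0 : Cx R) [set x : Cx R | `|x| < (d%:C)%C].
    by apply: (@nbhs_norm0P _ (Cx R) _).2; exists (d%:C)%C.
  by split; exact: nd.
case=> x y /= [hx hy]; apply: H => /=.
  by move: hx; rewrite norm_cnorm ltcR.
by move: hy; rewrite norm_cnorm ltcR.
Qed.

Lemma near_C2W (P : C2 R -> Prop) : (forall z : C2 R, P z) -> \forall z \near (0 : C2 R), P z.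
Proof. by move=> H; apply/near_C2P; exists 1. Qed.

Definition converges (u : nat -> Cx R) (l : Cx R) : Prop :=
  forall e : R, 0 < e -> exists n0, forall n, (n0 <= n)%N -> cnorm (u n - l) < e.

Lemma cvg_CxP (u : nat -> Cx R) (l : Cx R) : (u @ \oo --> l) <-> converges u l.
Proof.
split.
  move=> /cvgrPdist_lt H e e0.
  have eC : (0 : Cx R) < (e%:C)%C by rewrite ltcR.
  have [n0 _ Hn] := H _ eC; exists n0 => n n0n.
  by have := Hn n n0n; rewrite /= norm_cnorm ltcR cnorm_distC.
move=> H; apply/cvgrPdist_lt => e e0.
have [r r0 ->] := Cx_gt0P e0; have [n0 Hn] := H _ r0.
by exists n0 => // n /= n0n; rewrite norm_cnorm ltcR cnorm_distC; exact: Hn.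
Qed.

End Modulus.

(** * Germs of analytic functions as double power series *)

Section PowerSeries.
Variable R : realType.
Implicit Types (a b : nat -> nat -> Cx R) (f g : fgerm R) (z : C2 R).

Definition square_sum a n z : Cx R :=
  \sum_(i < n) \sum_(j < n) a i j * z.1 ^+ i * z.2 ^+ j.

Definition has_growth a (M r : R) :=
  0 < r /\ forall i j, cnorm (a i j) * r ^+ (i + j) <= M.

Definition has_series f a :=
  (exists M r, has_growth a M r) /\
  \forall z \near (0 : C2 R), converges (square_sum a ^~ z) (f z).

Lemma analyticP f : analytic f <-> exists a, has_series f a.
Proof.
split.
  case=> a [M [r [r0 Mr cv]]]; exists a; split; last first.
    by apply: filterS cv => z fz; exact/cvg_CxP.
  have [s s0 rs] := Cx_gt0P r0; exists (cnorm M), s; split => // i j.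
  have := Mr i j; rewrite rs norm_cnorm -rmorphXn -rmorphM /=.
  (* The order of [Cx R] is partial: anything above a nonnegative real is itself a nonnegative real,
     hence equal to its norm. *)
  move=> H; have M0 : 0 <= M.
    by apply: le_trans H; rewrite ler0c mulr_ge0 ?cnorm_ge0 ?exprn_ge0 ?ltW.
  by move: H; rewrite -[leRHS](ger0_norm M0) norm_cnorm lecR.
case=> a [[M [r [r0 Mr]]] cv]; exists a, (M%:C)%C, (r%:C)%C; split; last first.
- by apply: filterS cv => z fz; exact/cvg_CxP.
- by move=> i j; rewrite norm_cnorm -rmorphXn -rmorphM /= lecR.
by rewrite ltcR.
Qed.

Lemma has_growth_ge0 a M r : has_growth a M r -> 0 <= M.
Proof.
case=> r0 H; apply: le_trans (H 0%N 0%N).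
by rewrite mulr_ge0 ?cnorm_ge0 // exprn_ge0 // ltW.
Qed.

Lemma has_growth_term a M r q (x y : Cx R) i j : has_growth a M r ->
  cnorm x <= q * r -> cnorm y <= q * r ->
  cnorm (a i j * x ^+ i * y ^+ j) <= M * q ^+ (i + j).
Proof.
move=> [r0 H] hx hy.
have q0 : 0 <= q.
  by rewrite -(pmulr_lge0 _ r0); apply: le_trans hx; exact: cnorm_ge0.
rewrite !cnormM !cnormX -mulrA.
apply: (@le_trans _ _ (cnorm (a i j) * ((q * r) ^+ i * (q * r) ^+ j))).
  rewrite ler_wpM2l ?cnorm_ge0 // ler_pM ?exprn_ge0 ?cnorm_ge0 //.
    by rewrite lerXn2r // nnegrE ?cnorm_ge0 // mulr_ge0 // ltW.
  by rewrite lerXn2r // nnegrE ?cnorm_ge0 // mulr_ge0 // ltW.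
rewrite -exprD exprMn mulrCA mulrC ler_wpM2r ?exprn_ge0 //.
Qed.

Lemma near_small (d : R) : 0 < d ->
  \forall z \near (0 : C2 R), cnorm z.1 < d /\ cnorm z.2 < d.
Proof. by move=> d0; apply/near_C2P; exists d. Qed.

(** Tool for products, quotients and substitutions: the square sums of the result are compared with
    a sequence of known limit, up to a geometrically small tail. *)
Lemma cvg_Cx_trans (u v : nat -> Cx R) (l : Cx R) (C : R) :
  converges u l -> (forall n, cnorm (v n - u n) <= C * 2^-1 ^+ n) ->
  converges v l.
Proof.
move=> ul H e e0.
have e2 : 0 < e / 2 by rewrite divr_gt0.
have [n0 Hn0] := ul _ e2.
have : (fun n => C * 2^-1 ^+ n) @ \oo --> (0 : R).
  by apply: cvg_geometric; rewrite ger0_norm; lra.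
move/cvgrPdist_lt => /(_ _ e2) [n1 _ Hn1].
exists (maxn n0 n1) => n; rewrite geq_max => /andP[h0 h1].
have -> : v n - l = (v n - u n) + (u n - l) by rewrite addrA subrK.
apply: le_lt_trans (cnormD _ _) _.
have := Hn0 n h0; have := Hn1 n h1; rewrite /= sub0r normrN => h2 h3.
have := H n; have := ler_norm (C * 2^-1 ^+ n); lra.
Qed.

Lemma cvg_CxM (u v : nat -> Cx R) (l m : Cx R) :
  converges u l -> converges v m -> converges (fun n => u n * v n) (l * m).
Proof. by move=> /cvg_CxP ul /cvg_CxP vm; apply/cvg_CxP; exact: cvgM ul vm. Qed.

Lemma cvg_CxD (u v : nat -> Cx R) (l m : Cx R) :
  converges u l -> converges v m -> converges (fun n => u n + v n) (l + m).
Proof. by move=> /cvg_CxP ul /cvg_CxP vm; apply/cvg_CxP; exact: cvgD ul vm. Qed.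

Lemma cvg_CxS (u : nat -> Cx R) (l : Cx R) :
  converges u l -> converges (fun n => u n.+1) l.
Proof. by move=> H e /H[n0 h]; exists n0 => n hn; apply: h; exact: leqW. Qed.

(** Antidiagonals of index below n fill the triangle k + l < n, while products of square sums fill a
    whole square; the terms in between are the tail to be estimated. *)
Lemma triangle_sum (V : nmodType) (F : nat -> nat -> V) n :
  \sum_(i < n) \sum_(k < i.+1) F k (i - k)%N =
  \sum_(k < n) \sum_(l < n | (k + l < n)%N) F k l.
Proof.
have E m : \sum_(k < m) \sum_(l < m | (k + l < m)%N) F k l =
           \sum_(k < m) \sum_(l < m - k) F k l.
  apply: eq_bigr => k _.
  rewrite (big_ord_widen m (fun l => F k l)) ?leq_subr //.
  by apply: eq_bigl => l /=; rewrite ltn_subRL.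
rewrite {}E; elim: n => [|n IH]; first by rewrite !big_ord0.
rewrite big_ord_recr /= IH [RHS]big_ord_recr /= subSnn big_ord1.
rewrite [in LHS]big_ord_recr /= subnn addrA; congr (_ + _).
rewrite -big_split /=; apply: eq_bigr => k _.
by rewrite subSn 1?ltnW // big_ord_recr.
Qed.

Definition cauchy_prod a b i j : Cx R :=
  \sum_(k < i.+1) \sum_(l < j.+1) a k l * b (i - k)%N (j - l)%N.

Lemma square_sum_cauchy a b n z :
  square_sum (cauchy_prod a b) n z =
  \sum_(k < n) \sum_(k' < n | (k + k' < n)%N)
    \sum_(l < n) \sum_(l' < n | (l + l' < n)%N)
      (a k l * z.1 ^+ k * z.2 ^+ l) * (b k' l' * z.1 ^+ k' * z.2 ^+ l').
Proof.
rewrite -(@triangle_sum _ (fun k k' => \sum_(l < n)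
  \sum_(l' < n | (l + l' < n)%N) (a k l * z.1 ^+ k * z.2 ^+ l) *
  (b k' l' * z.1 ^+ k' * z.2 ^+ l'))).
apply: eq_bigr => i _.
under [RHS]eq_bigr => k _ do
  rewrite -(@triangle_sum _ (fun l l' => (a k l * z.1 ^+ k * z.2 ^+ l) *
    (b (i - k)%N l' * z.1 ^+ (i - k)%N * z.2 ^+ l'))).
rewrite exchange_big /=; apply: eq_bigr => j _.
rewrite /cauchy_prod !mulr_suml; apply: eq_bigr => k _.
rewrite !mulr_suml; apply: eq_bigr => l _.
have -> : z.1 ^+ i = z.1 ^+ k * z.1 ^+ (i - k)%N.
  by rewrite -exprD subnKC // -ltnS.
have -> : z.2 ^+ j = z.2 ^+ l * z.2 ^+ (j - l)%N.
  by rewrite -exprD subnKC // -ltnS.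
ring.
Qed.

Lemma has_growth_le a M r r' : has_growth a M r -> 0 < r' <= r ->
  has_growth a M r'.
Proof.
move=> [r0 H] /andP[r'0 rr]; split=> // i j; apply: le_trans (H i j).
rewrite ler_wpM2l ?cnorm_ge0 // lerXn2r // nnegrE ltW //.
Qed.

Lemma has_growth_common a b M r M' r' : has_growth a M r ->
  has_growth b M' r' -> exists s, has_growth a M s /\ has_growth b M' s.
Proof.
move=> ha hb; have [r0 _] := ha; have [r'0 _] := hb.
exists (Num.min r r'); split.
  by apply: has_growth_le ha _; rewrite lt_min r0 r'0 ge_min lexx.
by apply: has_growth_le hb _; rewrite lt_min r0 r'0 ge_min lexx orbT.
Qed.

Lemma ler_sum_ord n (F : 'I_n -> R) (P : pred 'I_n) (B : R) : 0 <= B ->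
  (forall i, P i -> F i <= B) -> \sum_(i < n | P i) F i <= n%:R * B.
Proof.
move=> B0 H; apply: (@le_trans _ _ (\sum_(i < n) B)).
  rewrite [leRHS](bigID P) /=; apply: ler_wpDr; first exact: sumr_ge0.
  exact: ler_sum.
by rewrite sumr_const card_ord mulr_natl.
Qed.

Lemma natr_le_exp2 n : (n%:R : R) <= 2 ^+ n.
Proof. by rewrite -natrX ler_nat ltnW // ltn_expl. Qed.

(** The coefficient of index (i, j) has (i+1)(j+1) terms, each at most M M' / r^(i+j); since n+1 <=
    4^n, dividing the radius by 4 absorbs their number. *)
Lemma has_growth_cauchy a b M M' r : has_growth a M r -> has_growth b M' r ->
  has_growth (cauchy_prod a b) (M * M') (r / 4).
Proof.
move=> ha hb; have [r0 Ha] := ha; have [_ Hb] := hb.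
have M0 := has_growth_ge0 ha; have M'0 := has_growth_ge0 hb.
split; first by rewrite divr_gt0.
move=> i j; rewrite expr_div_n.
have H1 : cnorm (cauchy_prod a b i j) * r ^+ (i + j) <=
          (i.+1)%:R * ((j.+1)%:R * (M * M')).
  have S (I : Type) (s : seq I) (P : pred I) (F : I -> Cx R) (x : R) :
      0 <= x -> cnorm (\sum_(i <- s | P i) F i) * x <=
                \sum_(i <- s | P i) cnorm (F i) * x.
    by move=> x0; rewrite -mulr_suml ler_wpM2r ?cnorm_sum.
  have rn : 0 <= r ^+ (i + j) by rewrite exprn_ge0 // ltW.
  apply: le_trans (S _ _ _ _ _ rn) _.
  apply: ler_sum_ord => [|k _]; first by rewrite !mulr_ge0.
  apply: le_trans (S _ _ _ _ _ rn) _.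
  apply: ler_sum_ord => [|l _]; first by rewrite !mulr_ge0.
  have -> : (i + j = (k + l) + ((i - k) + (j - l)))%N.
    by have := ltn_ord k; have := ltn_ord l; lia.
  have r0' := ltW r0.
  by rewrite cnormM exprD mulrACA ler_pM // mulr_ge0 ?cnorm_ge0 ?exprn_ge0.
have p4 n : (0 : R) < 4 ^+ n by rewrite exprn_gt0.
rewrite [leLHS]mulrA ler_pdivrMr //; apply: le_trans H1 _.
rewrite mulrA [leRHS]mulrC ler_wpM2r ?mulr_ge0 // exprD.
have H n : (n.+1)%:R <= 4 ^+ n :> R.
  by rewrite -natrX ler_nat; elim: n => // n IH; rewrite expnS; lia.
exact: ler_pM.
Qed.

(* The square sums of the product differ from the products of the square sums by
   at most n^4 terms, all of total degree at least n. *)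
Lemma has_seriesM f g a b : has_series f a -> has_series g b ->
  has_series (fun z => f z * g z) (cauchy_prod a b).
Proof.
move=> [[M [r ha]] fa] [[M' [r' hb]] gb].
have [s [{r}ha {r' }hb]] := has_growth_common ha hb.
split; first by exists (M * M'), (s / 4); exact: has_growth_cauchy.
have s0 := ha.1; have M0 := has_growth_ge0 ha; have M'0 := has_growth_ge0 hb.
(* At most n^4 <= 16^n terms, each bounded by M M' / 32^n on this polydisc, leave a tail of order
   2^-n. *)
have e0 : 0 < 32^-1 * s by rewrite mulr_gt0.
apply: filterS3 fa gb (near_small e0) => z fz gz [/ltW z1 /ltW z2].
apply: (cvg_Cx_trans (C := M * M') (cvg_CxM fz gz)) => n.
pose T k k' l l' :=
  (a k l * z.1 ^+ k * z.2 ^+ l) * (b k' l' * z.1 ^+ k' * z.2 ^+ l').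
have HT (k k' l l' : nat) : (n <= k + k' + (l + l'))%N ->
    cnorm (T k k' l l') <= M * M' * 32^-1 ^+ n.
  move=> kn; have := has_growth_term k l ha z1 z2.
  have := has_growth_term k' l' hb z1 z2.
  move=> h1 h2; rewrite /T cnormM.
  apply: (@le_trans _ _ (M * 32^-1 ^+ (k + l) * (M' * 32^-1 ^+ (k' + l')))).
    by rewrite ler_pM ?cnorm_ge0.
  rewrite mulrACA -exprD ler_wpM2l ?mulr_ge0 // ler_wiXn2l //; [lra|lia].
have B0 : 0 <= M * M' * 32^-1 ^+ n by rewrite !mulr_ge0 ?exprn_ge0.
have -> : square_sum a n z * square_sum b n z = \sum_(k < n) \sum_(k' < n)
    \sum_(l < n) \sum_(l' < n) T k k' l l'.
  rewrite /square_sum big_distrlr /=; apply: eq_bigr => k _.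
  by apply: eq_bigr => k' _; rewrite big_distrlr.
rewrite square_sum_cauchy.
apply: (@le_trans _ _ (n%:R * (n%:R * (n%:R * (n%:R * (M * M' * 32^-1 ^+ n)))))).
  rewrite -sumrB; apply: le_trans (cnorm_sum _ _ _) _.
  apply: ler_sum_ord => [|k _]; first by rewrite !(mulr_ge0 _ B0, mulr_ge0).
  rewrite big_mkcond -sumrB; apply: le_trans (cnorm_sum _ _ _) _.
  apply: ler_sum_ord => [|k' _]; first by rewrite !(mulr_ge0 _ B0, mulr_ge0).
  case: ltnP => kk'; last first.
    rewrite sub0r cnormN; apply: le_trans (cnorm_sum _ _ _) _.
    apply: ler_sum_ord => [|l _]; first by rewrite mulr_ge0.
    apply: le_trans (cnorm_sum _ _ _) _.
    by apply: ler_sum_ord => // l' _; apply: HT; lia.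
  rewrite -sumrB; apply: le_trans (cnorm_sum _ _ _) _.
  apply: ler_sum_ord => [|l _]; first by rewrite mulr_ge0.
  rewrite big_mkcond -sumrB; apply: le_trans (cnorm_sum _ _ _) _.
  apply: ler_sum_ord => // l' _; case: ltnP => ll'.
    by rewrite subrr cnorm0.
  by rewrite sub0r cnormN; apply: HT; lia.
have n2 := natr_le_exp2 n; have p2 : (0 : R) <= 2 ^+ n by rewrite exprn_ge0.
apply: (@le_trans _ _
  (2 ^+ n * (2 ^+ n * (2 ^+ n * (2 ^+ n * (M * M' * 32^-1 ^+ n)))))).
  by rewrite !(ler_pM, mulr_ge0 _ B0, mulr_ge0).
have E : 2 ^+ n * (2 ^+ n * (2 ^+ n * (2 ^+ n * 32^-1 ^+ n))) = 2^-1 ^+ n :> R.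
  by rewrite -!exprMn; congr (_ ^+ n); field.
by rewrite -E le_eqVlt; apply/orP; left; apply/eqP; ring.
Qed.


End PowerSeries.

(** Exchanging the coordinates turns the chart at the vertical direction into [chart (Some 0)], so
    that the analysis is done only for directions of finite slope. *)
Definition swap2 (R : realType) (z : C2 R) : C2 R := (z.2, z.1).

(* Strict differentiability at the origin. *)
Definition linearized (R : realType) (f : fgerm R) (al be : Cx R) : Prop :=
  forall e : R, 0 < e -> exists2 d : R, 0 < d & forall z z' : C2 R,
    cnorm z.1 < d -> cnorm z.2 < d -> cnorm z'.1 < d -> cnorm z'.2 < d ->
    cnorm (f z - f z' - (al * (z.1 - z'.1) + be * (z.2 - z'.2))) <=
    e * (cnorm (z.1 - z'.1) + cnorm (z.2 - z'.2)).

(** * Sums, quotients and substitutions of double power series *)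

Section SeriesOperations.
Variable R : realType.
Implicit Types (a b c : nat -> nat -> Cx R) (f g : fgerm R) (z : C2 R).

Lemma cvg_Cx_unique (u : nat -> Cx R) (l m : Cx R) :
  converges u l -> converges u m -> l = m.
Proof.
move=> ul um; apply/eqP; rewrite -subr_eq0 -cnorm_eq0; apply/eqP.
apply: le_anti; rewrite cnorm_ge0 andbT; apply/ler_addgt0Pr => e e0.
have e2 : 0 < e / 2 by rewrite divr_gt0.
have [n0 h0] := ul _ e2; have [n1 h1] := um _ e2.
have := h0 _ (leq_maxl n0 n1); have := h1 _ (leq_maxr n0 n1).
have := cnormD (l - u (maxn n0 n1)) (u (maxn n0 n1) - m).
rewrite addrA subrK (cnorm_distC l); lra.
Qed.

Lemma cvg_Cx_near_cst (u : nat -> Cx R) (l : Cx R) n0 :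
  (forall n, (n0 <= n)%N -> u n = l) -> converges u l.
Proof.
move=> H e e0; exists n0 => n /H ->.
by rewrite subrr cnorm0.
Qed.

Lemma cvg_Cx_le (u : nat -> Cx R) (l : Cx R) (B : R) n0 :
  converges u l -> (forall n, (n0 <= n)%N -> cnorm (u n) <= B) -> cnorm l <= B.
Proof.
move=> ul H; apply/ler_addgt0Pr => e e0.
have [n1 Hn1] := ul e e0.
have := Hn1 _ (leq_maxr n0 n1); have := H _ (leq_maxl n0 n1).
have := cnormD (l - u (maxn n0 n1)) (u (maxn n0 n1)).
rewrite subrK cnorm_distC; lra.
Qed.

Lemma has_series_monomial (x : Cx R) i0 j0 :
  has_series (fun z => x * z.1 ^+ i0 * z.2 ^+ j0)
    (fun i j => if (i == i0) && (j == j0) then x else 0).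
Proof.
split.
  exists (cnorm x), 1; split => // i j; rewrite expr1n mulr1.
  by case: ifP => // _; rewrite cnorm0 cnorm_ge0.
apply: near_C2W => z; apply: (cvg_Cx_near_cst (n0 := (i0 + j0).+1)) => n hn.
have hi : (i0 < n)%N by lia.
have hj : (j0 < n)%N by lia.
rewrite /square_sum (bigD1 (Ordinal hi)) //= (bigD1 (Ordinal hj)) //= !eqxx /=.
rewrite !big1 ?addr0 // => [i /negPf ni|j /negPf nj].
  rewrite big1 // => j _.
  by rewrite (_ : (i == i0 :> nat) = false) ?mul0r.
by rewrite (_ : (j == j0 :> nat) = false) ?mul0r.
Qed.

Lemma has_seriesD f g a b : has_series f a -> has_series g b ->
  has_series (fun z => f z + g z) (fun i j => a i j + b i j).
Proof.
move=> [[M [r ha]] fa] [[M' [r' hb]] gb].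
have [s [{r}ha {r' }hb]] := has_growth_common ha hb.
split.
  exists (M + M'), s; split => [|i j]; first exact: ha.1.
  apply: (@le_trans _ _ ((cnorm (a i j) + cnorm (b i j)) * s ^+ (i + j))).
    by rewrite ler_wpM2r ?cnormD // exprn_ge0 // ltW // ha.1.
  by rewrite mulrDl; apply: lerD; [exact: ha.2 | exact: hb.2].
apply: filterS2 fa gb => z fz gz.
suff -> : square_sum (fun i j => a i j + b i j) ^~ z =
          (fun n => square_sum a n z + square_sum b n z) by exact: cvg_CxD fz gz.
apply/funext => n; rewrite /square_sum -big_split; apply: eq_bigr => i _.
by rewrite -big_split; apply: eq_bigr => j _ /=; rewrite !mulrDl.
Qed.

Lemma has_series_ext f g a : (\forall z \near (0 : C2 R), f z = g z) ->
  has_series f a -> has_series g a.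
Proof.
by move=> fg [ha fa]; split => //; apply: filterS2 fg fa => z ->.
Qed.

Lemma near_swap2 (P : C2 R -> Prop) :
  (\forall z \near (0 : C2 R), P z) -> \forall z \near (0 : C2 R), P (swap2 z).
Proof.
by move=> /near_C2P[d d0 H]; apply/near_C2P; exists d => // z h1 h2; apply: H.
Qed.

Lemma has_series_swap2 f a : has_series f a ->
  has_series (f \o @swap2 R) (fun i j => a j i).
Proof.
move=> [[M [r [r0 ha]]] fa]; split.
  by exists M, r; split => // i j; rewrite addnC.
apply: filterS (near_swap2 fa) => z.
congr (converges _ _); apply/funext => n.
rewrite /square_sum exchange_big /=; apply: eq_bigr => i _.
by apply: eq_bigr => j _ /=; rewrite mulrAC.
Qed.

(* The last condition makes the quotient an explicit polynomial on z.1 = 0. *)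
Lemma has_series_div f c : has_series f c -> (forall k, c 0%N k = 0) ->
  (forall k, (1 < k)%N -> c 1%N k = 0) ->
  exists g, has_series g (fun m k => c m.+1 k) /\
    \forall z \near (0 : C2 R), f z = z.1 * g z.
Proof.
move=> [[M [r hc]] fc] c0 c1; have [r0 Hc] := hc.
exists (fun z => if z.1 == 0 then c 1%N 0%N + c 1%N 1%N * z.2 else f z / z.1).
split; [split|].
- exists (M / r), r; split => // i j.
  by rewrite ler_pdivlMr // -mulrA -exprSr -addSn.
(* With radius r/4, the n+1 terms of a column of index n add up to at most (n+1) M / 4^n <= M /
   2^n. *)
- have r4 : 0 < 4^-1 * r by rewrite mulr_gt0.
  apply: filterS2 fc (near_small r4) => z fz [/ltW hx /ltW hy].
  case: eqVneq => [z0|z0].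
    apply: (cvg_Cx_near_cst (n0 := 2%N)) => -[|[|n]] // _.
    rewrite /square_sum big_ord_recl addrC big1 => [|i _]; last first.
      by rewrite big1 // => j _; rewrite z0 lift0 expr0n /= mulr0 mul0r.
    rewrite add0r big_ord_recl big_ord_recl addrA addrC big1 => [|j _]; last first.
      by rewrite c1 // !mul0r.
    by rewrite add0r /= !expr0 !expr1 !mulr1.
  have fz' : converges (fun n => square_sum c n.+1 z / z.1) (f z / z.1).
    apply: cvg_CxM; first exact: cvg_CxS fz.
    exact: (cvg_Cx_near_cst (n0 := 0%N)).
  apply: (cvg_Cx_trans (C := M * cnorm z.1^-1) fz') => n.
  (* Without its zero row, the square of size n+1 of [c] has n rows and n+1 columns: only its last
     column separates it from the square of size n of the shifted family. *)
  have -> : square_sum (fun m k => c m.+1 k) n z - square_sum c n.+1 z / z.1 =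
      - ((\sum_(i < n.+1) c i n * z.1 ^+ i * z.2 ^+ n) / z.1).
    have -> : square_sum c n.+1 z = \sum_(i < n.+1) c i n * z.1 ^+ i * z.2 ^+ n +
        z.1 * square_sum (fun m k => c m.+1 k) n z.
      rewrite /square_sum.
      under eq_bigr => i _ do rewrite big_ord_recr /= addrC.
      rewrite big_split /=; congr (_ + _).
      rewrite big_ord_recl big1 ?add0r => [|j _]; last by rewrite c0 !mul0r.
      rewrite mulr_sumr; apply: eq_bigr => i _; rewrite mulr_sumr.
      by apply: eq_bigr => j _; rewrite /= /bump /= add1n exprS; ring.
    by field.
  rewrite cnormN cnormM mulrC [M * _]mulrC -mulrA ler_wpM2l ?cnorm_ge0 //.
  apply: le_trans (cnorm_sum _ _ _) _.
  have M0 := has_growth_ge0 hc.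
  apply: (@le_trans _ _ (n.+1%:R * (M * 4^-1 ^+ n))).
    apply: ler_sum_ord => [|i _]; first by rewrite mulr_ge0 ?exprn_ge0.
    apply: le_trans (has_growth_term _ _ hc hx hy) _.
    by rewrite ler_wpM2l // ler_wiXn2l ?leq_addl //; lra.
  rewrite mulrCA ler_wpM2l //.
  have -> : (2^-1 : R) ^+ n = 2 ^+ n * 4^-1 ^+ n.
    by rewrite -exprMn; congr (_ ^+ n); field.
  rewrite ler_wpM2r ?exprn_ge0 // -natrX ler_nat.
  by elim: (n) => // m IH; rewrite expnS; lia.
apply: filterS fc => z fz; case: eqVneq => [z0|z0]; last by rewrite mulrC divfK.
rewrite z0 mul0r; apply: cvg_Cx_unique fz _.
apply: (cvg_Cx_near_cst (n0 := 0%N)) => n _.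
rewrite /square_sum big1 // => i _; rewrite big1 // => j _.
by case: (nat_of_ord i) => [|m]; rewrite ?c0 z0 ?expr0n ?mulr0 ?mul0r.
Qed.

(** Coefficient of z1^m z2^k in f(z1, z1 (z2 + t)): the monomial x^i y^j contributes only to m = i +
    j, through the binomial expansion of (z2 + t)^j. The truncation of j - k is harmless, the
    binomial being 0 there. *)
Definition chart_coef (t : Cx R) a (m k : nat) : Cx R :=
  \sum_(j < m.+1) a (m - j)%N j * ('C(j, k)%:R * t ^+ (j - k)).

Lemma near_chart d (P : C2 R -> Prop) : (\forall z \near (0 : C2 R), P z) ->
  \forall z \near (0 : C2 R), P (chart d z).
Proof.
move=> /near_C2P[e e0 H].
case: d => [t|] /=; apply/near_C2P.
  have t1 : 0 < cnorm t + 1 by rewrite ltr_wpDl ?cnorm_ge0.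
  exists (Num.min 1 (e / (cnorm t + 1))); first by rewrite lt_min ltr01 divr_gt0.
  move=> z; rewrite !lt_min !ltr_pdivlMr // => /andP[_ h1] /andP[h2 _].
  have h3 : cnorm z.1 * cnorm t < e.
    apply: le_lt_trans h1; rewrite mulrDr lerDl mulr1; exact: cnorm_ge0.
  have h4 : cnorm z.1 < e.
    apply: le_lt_trans h1; rewrite mulrDr mulr1 lerDr mulr_ge0 //; exact: cnorm_ge0.
  apply: H => //=; apply: le_lt_trans h1; rewrite cnormM ler_wpM2l ?cnorm_ge0 //.
  by apply: le_trans (cnormD _ _) _; rewrite addrC lerD2l ltW.
exists (Num.min 1 e); first by rewrite lt_min ltr01.
move=> z; rewrite !lt_min => /andP[h1 _] /andP[_ h2]; apply: H => //=.
rewrite cnormM; apply: le_lt_trans h2; rewrite ler_piMl ?cnorm_ge0 //.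
exact: ltW.
Qed.

Lemma bin_le_exp2 j k : ('C(j, k) <= 2 ^ j)%N.
Proof.
elim: j k => [|j IH] [|k] //; first by rewrite bin0 expn_gt0.
by rewrite binS expnS mul2n -addnn leq_add.
Qed.

Lemma square_sum_chart t a n z : square_sum (chart_coef t a) n z =
  \sum_(j < n) \sum_(i < n | (j + i < n)%N)
    a i j * z.1 ^+ i * (z.1 * (z.2 + t)) ^+ j.
Proof.
rewrite -(triangle_sum (fun j i => a i j * z.1 ^+ i * (z.1 * (z.2 + t)) ^+ j)).
apply: eq_bigr => m _; rewrite /chart_coef.
under eq_bigr => k _ do rewrite !mulr_suml.
rewrite exchange_big /=; apply: eq_bigr => j _.
have jm : (j <= m)%N by rewrite -ltnS.
have -> : a (m - j)%N j * z.1 ^+ (m - j) * (z.1 * (z.2 + t)) ^+ j =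
          a (m - j)%N j * z.1 ^+ m * (t + z.2) ^+ j.
  have -> : z.1 ^+ m = z.1 ^+ (m - j) * z.1 ^+ j by rewrite -exprD subnK.
  by rewrite exprMn addrC; ring.
rewrite exprDn mulr_sumr (big_ord_widen n (fun k => a (m - j)%N j * z.1 ^+ m *
  (t ^+ (j - k) * z.2 ^+ k *+ 'C(j, k)))); last by have := ltn_ord m; lia.
rewrite [RHS]big_mkcond; apply: eq_bigr => k _; case: ifP => kj.
  by rewrite -mulr_natl; ring.
by rewrite bin_small ?mul0r ?mulr0 ?mul0r //; lia.
Qed.

Lemma has_series_chart t f a : has_series f a ->
  has_series (f \o chart (Some t)) (chart_coef t a).
Proof.
move=> [[M [r ha]] fa]; have [r0 Ha] := ha; have M0 := has_growth_ge0 ha.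
have t0 := cnorm_ge0 t; pose T : R := 1 + cnorm t.
have T1 : 1 <= T by rewrite /T lerDl.
have T0 : 0 < T by apply: lt_le_trans T1.
split.
  (* In 4 T, one factor 2 pays for the binomial coefficients, the other for the m+1 terms, and T for
     the powers of t; s <= 1 lets the exponent k be dropped. *)
  pose s := Num.min 1 (r / (4 * T)).
  have s0 : 0 < s by rewrite lt_min ltr01 divr_gt0 ?mulr_gt0.
  have s1 : s <= 1 by rewrite ge_min lexx.
  have sr : s * (4 * T) <= r by rewrite -ler_pdivlMr ?mulr_gt0 // ge_min lexx orbT.
  exists M, s; split => // m k.
  apply: (@le_trans _ _ (cnorm (chart_coef t a m k) * s ^+ m)).
    by rewrite ler_wpM2l ?cnorm_ge0 // ler_wiXn2l ?leq_addr // ltW.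
  rewrite /chart_coef.
  apply: (@le_trans _ _ (\sum_(j < m.+1)
      cnorm (a (m - j)%N j * ('C(j, k)%:R * t ^+ (j - k))) * s ^+ m)).
    by rewrite -mulr_suml ler_wpM2r ?cnorm_sum // exprn_ge0 // ltW.
  have p0 : (0 : R) < 2 ^+ m by rewrite exprn_gt0.
  apply: (@le_trans _ _ (m.+1%:R * (M / 2 ^+ m))); last first.
    rewrite mulrCA ler_piMr // ler_pdivrMr // mul1r -natrX ler_nat.
    by elim: (m) => // n IH; rewrite expnS; lia.
  apply: ler_sum_ord => [|j _]; first by rewrite divr_ge0 // ltW.
  have jm : (j <= m)%N by rewrite -ltnS.
  rewrite ler_pdivlMr // !cnormM cnormX.
  have h1 : cnorm ('C(j, k)%:R : Cx R) <= 2 ^+ m.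
    apply: (@le_trans _ _ (2 ^+ j)); last by rewrite ler_weXn2l //; lra.
    rewrite -natrX; apply: (@le_trans _ _ ('C(j, k)%:R)).
      rewrite -(@cnorm_real R 'C(j, k)%:R) //.
      by rewrite (_ : (('C(j, k)%:R)%:C)%C = 'C(j, k)%:R :> R[i]) // rmorph_nat.
    by rewrite ler_nat bin_le_exp2.
  have h2 : cnorm t ^+ (j - k) <= T ^+ m.
    apply: (@le_trans _ _ (T ^+ (j - k))).
      by rewrite lerXn2r ?nnegrE ?(ltW T0) // /T lerDr.
    by rewrite ler_weXn2l //; lia.
  apply: (@le_trans _ _
    (cnorm (a (m - j)%N j) * (2 ^+ m * T ^+ m) * s ^+ m * 2 ^+ m)).
    rewrite ler_wpM2r ?(ltW p0) // ler_wpM2r ?exprn_ge0 ?(ltW s0) //.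
    by rewrite ler_wpM2l ?cnorm_ge0 // ler_pM ?cnorm_ge0 ?exprn_ge0.
  apply: (@le_trans _ _ (cnorm (a (m - j)%N j) * r ^+ (m - j + j))); last exact: Ha.
  rewrite subnK // -!mulrA ler_wpM2l ?cnorm_ge0 // -!exprMn.
  rewrite lerXn2r ?nnegrE ?(ltW r0) ?mulr_ge0 ?(ltW s0) ?(ltW T0) //.
  by apply: le_trans sr; rewrite le_eqVlt; apply/orP; left; apply/eqP; ring.
(* At most n^2 <= 4^n terms lie outside the triangle, each bounded by M / 8^n. *)
have r8 : 0 < 8^-1 * r by rewrite mulr_gt0.
apply: filterS2 (near_chart (Some t) fa) (near_chart (Some t) (near_small r8)).
move=> z fz [/ltW hx /ltW hy].
apply: (cvg_Cx_trans (C := M) fz) => n.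
rewrite square_sum_chart /square_sum exchange_big /=.
apply: (@le_trans _ _ (n%:R * (n%:R * (M * 8^-1 ^+ n)))).
  have B0 : 0 <= M * 8^-1 ^+ n by rewrite mulr_ge0 ?exprn_ge0.
  rewrite -sumrB; apply: le_trans (cnorm_sum _ _ _) _.
  apply: ler_sum_ord => [|j _]; first by rewrite mulr_ge0.
  rewrite big_mkcond -sumrB; apply: le_trans (cnorm_sum _ _ _) _.
  apply: ler_sum_ord => // i _; case: ltnP => ij.
    by rewrite subrr cnorm0.
  rewrite sub0r cnormN; apply: le_trans (has_growth_term _ _ ha hx hy) _.
  by rewrite ler_wpM2l // ler_wiXn2l //; [lra | lia].
rewrite mulrA mulrCA ler_wpM2l //.
have -> : (2^-1 : R) ^+ n = 2 ^+ n * 2 ^+ n * 8^-1 ^+ n.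
  by rewrite -!exprMn; congr (_ ^+ n); field.
have n2 := natr_le_exp2 R n.
by rewrite ler_wpM2r ?exprn_ge0 // ler_pM.
Qed.

End SeriesOperations.

(** * Differentiability and implicit functions *)

Section Linearization.
Variable R : realType.
Implicit Types (a : nat -> nat -> Cx R) (f g : fgerm R) (z : C2 R).

(** The mean value bound with d^(i-1), multiplied by d on both sides so that i = 0 needs no special
    exponent. *)
Lemma cnorm_expB (x x' : Cx R) (d : R) i : cnorm x <= d -> cnorm x' <= d ->
  cnorm (x ^+ i - x' ^+ i) * d <= i%:R * d ^+ i * cnorm (x - x').
Proof.
move=> hx hx'; have d0 := le_trans (cnorm_ge0 x) hx.
elim: i => [|i IH]; first by rewrite !expr0 subrr cnorm0 !mul0r.
have -> : x ^+ i.+1 - x' ^+ i.+1 = x * (x ^+ i - x' ^+ i) + (x - x') * x' ^+ i.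
  by rewrite !exprS; ring.
apply: le_trans (ler_wpM2r d0 (cnormD _ _)) _; rewrite mulrDl.
apply: (@le_trans _ _ (d * (i%:R * d ^+ i * cnorm (x - x')) +
                       cnorm (x - x') * d ^+ i * d)); last first.
  by rewrite -natr1 exprS le_eqVlt; apply/orP; left; apply/eqP; ring.
apply: lerD.
  by rewrite cnormM -[leLHS]mulrA ler_pM ?mulr_ge0 ?cnorm_ge0.
rewrite cnormM cnormX ler_wpM2r // ler_wpM2l ?cnorm_ge0 //.
by rewrite lerXn2r // nnegrE ?cnorm_ge0.
Qed.

Lemma cnorm_monomialB z z' (d : R) i j :
  cnorm z.1 <= d -> cnorm z.2 <= d -> cnorm z'.1 <= d -> cnorm z'.2 <= d ->
  cnorm (z.1 ^+ i * z.2 ^+ j - z'.1 ^+ i * z'.2 ^+ j) * d <=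
  (i + j)%:R * d ^+ (i + j) * (cnorm (z.1 - z'.1) + cnorm (z.2 - z'.2)).
Proof.
move=> h1 h2 h1' h2'; have d0 := le_trans (cnorm_ge0 _) h1.
have -> : z.1 ^+ i * z.2 ^+ j - z'.1 ^+ i * z'.2 ^+ j =
  (z.1 ^+ i - z'.1 ^+ i) * z.2 ^+ j + z'.1 ^+ i * (z.2 ^+ j - z'.2 ^+ j) by ring.
apply: le_trans (ler_wpM2r d0 (cnormD _ _)) _; rewrite mulrDl !cnormM !cnormX.
have H1 := cnorm_expB i h1 h1'; have H2 := cnorm_expB j h2 h2'.
have pi : cnorm z'.1 ^+ i <= d ^+ i by rewrite lerXn2r // nnegrE ?cnorm_ge0.
have pj : cnorm z.2 ^+ j <= d ^+ j by rewrite lerXn2r // nnegrE ?cnorm_ge0.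
have c1 := cnorm_ge0 (z.1 - z'.1); have c2 := cnorm_ge0 (z.2 - z'.2).
apply: (@le_trans _ _ (i%:R * d ^+ i * cnorm (z.1 - z'.1) * d ^+ j +
                       d ^+ i * (j%:R * d ^+ j * cnorm (z.2 - z'.2)))).
  apply: lerD.
    by rewrite mulrAC ler_pM ?exprn_ge0 ?cnorm_ge0 ?mulr_ge0 ?cnorm_ge0.
  by rewrite -[leLHS]mulrA ler_pM ?exprn_ge0 ?cnorm_ge0 ?mulr_ge0 ?cnorm_ge0.
rewrite natrD exprD -subr_ge0.
have -> : (i%:R + j%:R) * (d ^+ i * d ^+ j) *
    (cnorm (z.1 - z'.1) + cnorm (z.2 - z'.2)) -
    (i%:R * d ^+ i * cnorm (z.1 - z'.1) * d ^+ j +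
     d ^+ i * (j%:R * d ^+ j * cnorm (z.2 - z'.2))) =
  d ^+ i * d ^+ j * (j%:R * cnorm (z.1 - z'.1) + i%:R * cnorm (z.2 - z'.2)).
  by ring.
by rewrite !(mulr_ge0, addr_ge0) ?exprn_ge0.
Qed.

Lemma geometric_sum_le2 n : \sum_(i < n) (4^-1 : R) ^+ i <= 2.
Proof.
suff H : \sum_(i < n) (4^-1 : R) ^+ i <= 2 - 2 * 4^-1 ^+ n.
  by apply: le_trans H _; rewrite gerBl mulr_ge0 ?exprn_ge0.
elim: n => [|n IH]; first by rewrite big_ord0 expr0; lra.
rewrite big_ord_recr /= exprS; have : 0 <= (4^-1 : R) ^+ n by rewrite exprn_ge0.
move: IH; set S := \sum_(_ < _) _; set q := _ ^+ n; lra.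
Qed.

Lemma square_sum_head a n z : square_sum a n.+2 z =
  a 0%N 0%N + a 1%N 0%N * z.1 + a 0%N 1%N * z.2 +
  \sum_(i < n.+2) \sum_(j < n.+2)
     (if (1 < i + j)%N then a i j * (z.1 ^+ i * z.2 ^+ j) else 0).
Proof.
rewrite /square_sum.
have E : \sum_(i < n.+2) \sum_(j < n.+2) (a i j * z.1 ^+ i * z.2 ^+ j -
     (if (1 < i + j)%N then a i j * (z.1 ^+ i * z.2 ^+ j) else 0)) =
  a 0%N 0%N + a 1%N 0%N * z.1 + a 0%N 1%N * z.2.
  have T i j : (1 < i + j)%N -> a i j * z.1 ^+ i * z.2 ^+ j -
     (if (1 < i + j)%N then a i j * (z.1 ^+ i * z.2 ^+ j) else 0) = 0.
    by move=> ->; rewrite mulrA subrr.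
  rewrite big_ord_recl big_ord_recl addrA addrC big1 ?add0r => [|i _]; last first.
    by rewrite big1 // => j _; rewrite T // !lift0; lia.
  rewrite big_ord_recl big_ord_recl addrA [in X in X + _]addrC big1 ?add0r => [|j _]; last first.
    by rewrite T // !lift0 /=; lia.
  rewrite [X in _ + X]big_ord_recl [X in _ + (_ + X)]big1 => [|j _]; last first.
    by rewrite T // !lift0 /=; lia.
  by rewrite /= !subr0 !expr0 !expr1; ring.
rewrite -E -big_split; apply: eq_bigr => i _; rewrite -big_split.
by apply: eq_bigr => j _ /=; rewrite subrK.
Qed.

(** The terms of degree at least two have, on a polydisc of radius d, a Lipschitz constant that
    tends to 0 with d. *)
Lemma has_series_linearized f a : has_series f a ->
  linearized f (a 1%N 0%N) (a 0%N 1%N).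
Proof.
move=> [[M [r ha]] fa] e e0; have [r0 Ha] := ha; have M0 := has_growth_ge0 ha.
have [d1 d10 Hd1] := (near_C2P _).1 fa.
have M1 : 0 < 128 * (M + 1) by lra.
(* With d = q r / 2, the half absorbs the factor i + j <= 2^(i+j). As q <= 1/4, the remainder is
   dominated by 16 M q^2 times a double geometric series of sum at most 4, and 64 M q <= e r / 2
   brings it below [e * D * d]. [M + 1] keeps the denominator positive. *)
pose q := Num.min 4^-1 (e * r / (128 * (M + 1))).
have q0 : 0 < q.
  by rewrite lt_min; apply/andP; split; [lra | rewrite divr_gt0 // mulr_gt0].
have q4 : q <= 4^-1 by rewrite ge_min lexx.
have qe : q * (128 * (M + 1)) <= e * r.
  by rewrite -ler_pdivlMr // ge_min lexx orbT.
pose d := q * r / 2; have d0 : 0 < d by rewrite divr_gt0 ?mulr_gt0.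
exists (Num.min d d1); first by rewrite lt_min d0.
move=> z z'; rewrite !lt_min.
move=> /andP[/ltW h1 g1] /andP[/ltW h2 g2] /andP[/ltW h1' g1'] /andP[/ltW h2' g2'].
have cz := Hd1 _ g1 g2; have cz' := Hd1 _ g1' g2'.
set D := cnorm (z.1 - z'.1) + cnorm (z.2 - z'.2).
have D0 : 0 <= D by rewrite addr_ge0 ?cnorm_ge0.
set L := a 1%N 0%N * _ + _.
have cv : converges (fun n => square_sum a n z + - 1 * square_sum a n z' + - L)
                    (f z + - 1 * f z' + - L).
  apply: cvg_CxD; last exact: (cvg_Cx_near_cst (n0 := 0%N)).
  apply: cvg_CxD => //; apply: cvg_CxM => //.
  exact: (cvg_Cx_near_cst (n0 := 0%N)).
rewrite mulN1r in cv; apply: (cvg_Cx_le (n0 := 2%N) cv) => -[|[|n]] // _.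
rewrite mulN1r !square_sum_head /L.
set Sz := \sum_(i < _) _; set Sz' := \sum_(i < _) _.
rewrite (_ : _ + - _ = Sz - Sz'); last by ring.
rewrite -(ler_pM2r d0) /Sz /Sz' -sumrB.
apply: le_trans (ler_wpM2r (ltW d0) (cnorm_sum _ _ _)) _; rewrite mulr_suml.
apply: (@le_trans _ _ (\sum_(i < n.+2) \sum_(j < n.+2)
   (M * q ^+ 2 * 16 * D * (4^-1 ^+ i * 4^-1 ^+ j)))).
  apply: ler_sum => i _; rewrite -sumrB.
  apply: le_trans (ler_wpM2r (ltW d0) (cnorm_sum _ _ _)) _; rewrite mulr_suml.
  apply: ler_sum => j _; case: ifP => ij; last first.
    by rewrite subrr cnorm0 mul0r !mulr_ge0 ?exprn_ge0 // ltW.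
  rewrite -mulrBr cnormM -[leLHS]mulrA.
  apply: le_trans (ler_wpM2l (cnorm_ge0 _) (cnorm_monomialB i j h1 h2 h1' h2')) _.
  have H1 : (i + j)%:R * d ^+ (i + j) <= (q * r) ^+ (i + j).
    have -> : q * r = 2 * d by rewrite /d; field.
    rewrite [leRHS]exprMn ler_wpM2r ?exprn_ge0 ?(ltW d0) //; exact: natr_le_exp2.
  apply: (@le_trans _ _ (cnorm (a i j) * ((q * r) ^+ (i + j) * D))).
    by rewrite ler_wpM2l ?cnorm_ge0 // ler_wpM2r.
  have -> : cnorm (a i j) * ((q * r) ^+ (i + j) * D) =
      (cnorm (a i j) * r ^+ (i + j)) * (q ^+ (i + j) * D) by rewrite exprMn; ring.
  apply: (@le_trans _ _ (M * (q ^+ (i + j) * D))).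
    by rewrite ler_wpM2r ?Ha // mulr_ge0 ?exprn_ge0 // ltW.
  have [m Em] : exists m, (i + j = m.+2)%N by move: ij; clear; case: (_ + _)%N => [|[|m]] // _; exists m.
  have -> : M * q ^+ 2 * 16 * D * (4^-1 ^+ i * 4^-1 ^+ j) =
            M * (q ^+ 2 * 4^-1 ^+ m * D).
    by rewrite -exprD Em !exprS; field.
  rewrite Em -addn2 addnC exprD ler_wpM2l // ler_wpM2r //.
  by rewrite ler_wpM2l ?exprn_ge0 ?(ltW q0) // lerXn2r // nnegrE ltW.
have -> : \sum_(i < n.+2) \sum_(j < n.+2)
    (M * q ^+ 2 * 16 * D * (4^-1 ^+ i * 4^-1 ^+ j)) =
  M * q ^+ 2 * 16 * D * ((\sum_(i < n.+2) 4^-1 ^+ i) * (\sum_(i < n.+2) 4^-1 ^+ i)).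
  by rewrite big_distrlr mulr_sumr; apply: eq_bigr => i _; rewrite mulr_sumr.
apply: (@le_trans _ _ (M * q ^+ 2 * 16 * D * (2 * 2))).
  rewrite ler_wpM2l ?mulr_ge0 ?exprn_ge0 ?(ltW q0) //.
  by rewrite ler_pM ?sumr_ge0 ?geometric_sum_le2 // => i _; rewrite exprn_ge0.
have -> : M * q ^+ 2 * 16 * D * (2 * 2) = (64 * M * q) * (q * D) by ring.
have -> : e * D * d = (e * r / 2) * (q * D) by rewrite /d; ring.
rewrite ler_wpM2r ?mulr_ge0 ?(ltW q0) //.
nra.
Qed.

Lemma has_series_at0 f a : has_series f a -> f 0 = a 0%N 0%N.
Proof.
move=> [_ fa]; have [d d0 H] := (near_C2P _).1 fa.
have -> : (0 : C2 R) = (0 : Cx R, 0 : Cx R) by [].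
have c0 : converges (square_sum a ^~ (0, 0)) (f (0, 0)).
  have c00 : cnorm (0 : Cx R) < d by rewrite cnorm0.
  exact: (H (0, 0) c00 c00).
apply: cvg_Cx_unique c0 _; apply: (cvg_Cx_near_cst (n0 := 1%N)) => -[|n] // _.
rewrite /square_sum big_ord_recl addrC big1 => [|i _]; last first.
  by rewrite big1 // => j _; rewrite lift0 expr0n /= mulr0 mul0r.
rewrite add0r big_ord_recl addrC big1 => [|i _]; last first.
  by rewrite lift0 [X in _ * X]exprS mul0r mulr0.
by rewrite add0r /= !expr0 !mulr1.
Qed.

Lemma analytic_linearized f : analytic f -> exists al be, linearized f al be.
Proof. by move=> /analyticP[a /has_series_linearized h]; do 2 eexists; exact: h. Qed.

Lemma linearized_swap2 f al be : linearized f al be ->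
  linearized (f \o @swap2 R) be al.
Proof.
move=> H e e0; have [d d0 Hd] := H _ e0; exists d => // z z' h1 h2 h1' h2'.
have /= := Hd (swap2 z) (swap2 z') h2 h1 h2' h1'.
by rewrite (addrC (al * _)) (addrC (cnorm (z.2 - _))).
Qed.

Lemma linearized_lipschitz f al be : linearized f al be ->
  exists2 C : R, 0 < C & exists2 d : R, 0 < d & forall z z' : C2 R,
    cnorm z.1 < d -> cnorm z.2 < d -> cnorm z'.1 < d -> cnorm z'.2 < d ->
    cnorm (f z - f z') <= C * (cnorm (z.1 - z'.1) + cnorm (z.2 - z'.2)).
Proof.
move=> H; exists (1 + cnorm al + cnorm be).
  by have := cnorm_ge0 al; have := cnorm_ge0 be; lra.
have [d d0 Hd] := H 1 ltr01; exists d => // z z' h1 h2 h1' h2'.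
have := Hd z z' h1 h2 h1' h2'.
have := cnormD (f z - f z' - (al * (z.1 - z'.1) + be * (z.2 - z'.2)))
               (al * (z.1 - z'.1) + be * (z.2 - z'.2)).
rewrite subrK; have := cnormD (al * (z.1 - z'.1)) (be * (z.2 - z'.2)).
rewrite !cnormM.
have := mulr_ge0 (cnorm_ge0 al) (cnorm_ge0 (z.2 - z'.2)).
have := mulr_ge0 (cnorm_ge0 be) (cnorm_ge0 (z.1 - z'.1)).
move: (cnorm _) (cnorm _) (cnorm _) (cnorm _) => x1 x2 x3 x4; nra.
Qed.

End Linearization.

Section ImplicitFunction.
Variable R : realType.
Implicit Types (f g : fgerm R) (x y al be : Cx R).

(** Adding 2 C / 2^n, a bound for the sum of the remaining steps, makes the sequence nonincreasing
    and bounded below. *)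
Lemma is_cvg_fast_real (v : nat -> R) (C : R) :
  (forall n, `|v n.+1 - v n| <= C * 2^-1 ^+ n) -> cvg (v @ \oo).
Proof.
move=> H.
have C0 : 0 <= C by have := le_trans (normr_ge0 _) (H 0%N); rewrite expr0 mulr1.
pose w n := v n + 2 * C * 2^-1 ^+ n.
have wn n : w n.+1 <= w n.
  have := H n; rewrite ler_norml /w exprS => /andP[_].
  move: (2^-1 ^+ n) => q; lra.
have gc : (fun n => 2 * C * 2^-1 ^+ n) @ \oo --> (0 : R).
  by apply: cvg_geometric; rewrite ger0_norm; lra.
have vlb n : v 0%N - 2 * C + 2 * C * 2^-1 ^+ n <= v n.
  elim: n => [|n IH]; first by rewrite expr0 mulr1 subrK.
  have := H n; rewrite ler_norml exprS => /andP[+ _].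
  by move: IH; move: (2^-1 ^+ n) => q; lra.
have cw : cvg (w @ \oo).
  apply: nonincreasing_is_cvgn; first exact/nonincreasing_seqP.
  exists (v 0%N - 2 * C) => _ [n _ <-]; rewrite /w.
  have := vlb n; have : 0 <= 2 * C * 2^-1 ^+ n by rewrite !mulr_ge0 ?exprn_ge0.
  by move: (2^-1 ^+ n) => q; lra.
have -> : v = w \- (fun n => 2 * C * 2^-1 ^+ n).
  by apply/funext => n; rewrite /w /= addrK.
by apply: is_cvgB => //; apply/cvg_ex; exists 0.
Qed.

Lemma converges_fast (u : nat -> Cx R) (C : R) :
  (forall n, cnorm (u n.+1 - u n) <= C * 2^-1 ^+ n) -> exists l, converges u l.
Proof.
move=> H.
have hr : cvg ((fun n => complex.Re (u n : R[i])) @ \oo).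
  apply: (is_cvg_fast_real (C := C)) => n; apply: le_trans (H n).
  by apply: le_trans (normr_Re_le _); case: (u n.+1) (u n) => [a b] [a' b'].
have hi : cvg ((fun n => complex.Im (u n : R[i])) @ \oo).
  apply: (is_cvg_fast_real (C := C)) => n; apply: le_trans (H n).
  by apply: le_trans (normr_Im_le _); case: (u n.+1) (u n) => [a b] [a' b'].
move/cvg_ex: hr => [a ha]; move/cvg_ex: hi => [b hb].
exists (a +i* b)%C => e e0; have e2 : 0 < e / 2 by rewrite divr_gt0.
have /cvgrPdist_lt/(_ _ e2)[n0 _ H0] := ha.
have /cvgrPdist_lt/(_ _ e2)[n1 _ H1] := hb.
exists (maxn n0 n1) => n; rewrite geq_max => /andP[h0 h1].
have := H0 n h0; have := H1 n h1; rewrite /= distrC => k1; rewrite distrC => k0.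
apply: le_lt_trans (cnorm_le_ReIm _) _.
move: k0 k1; case: (u n) => c d /=; lra.
Qed.

(** With error slope |be| / 2, [f] varies along a vertical line by at least half of |be (y -
    y')|. *)
Lemma linearized_unique f al be : linearized f al be -> be != 0 ->
  exists2 d : R, 0 < d & forall x y y', cnorm x < d -> cnorm y < d ->
    cnorm y' < d -> f (x, y) = 0 -> f (x, y') = 0 -> y = y'.
Proof.
rewrite -cnorm_gt0 => H b0; have e0 : 0 < cnorm be / 2 by rewrite divr_gt0.
have [d d0 Hd] := H _ e0; exists d => // x y y' hx hy hy' fy fy'.
have := Hd (x, y) (x, y') hx hy hx hy'.
rewrite /= fy fy' !subrr mulr0 !add0r cnormN cnormM cnorm0 add0r => le2.
apply/eqP; rewrite -subr_eq0 -cnorm_eq0; apply/eqP; apply: le_anti.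
by rewrite cnorm_ge0 andbT; move: le2; have := cnorm_ge0 (y - y'); nra.
Qed.

(** Newton iteration with frozen derivative: y - f(x, y) / be is a contraction of ratio 1/2 in y,
    and its fixed point is the zero sought. *)
Lemma linearized_solve f al be (r : R) : linearized f al be -> be != 0 ->
  f 0 = 0 -> 0 < r ->
  exists2 d : R, 0 < d & forall x, cnorm x < d ->
    exists2 y, cnorm y < r & f (x, y) = 0.
Proof.
move=> H bn f0 r0; have b0 : 0 < cnorm be by rewrite cnorm_gt0.
have e0 : 0 < cnorm be / 2 by rewrite divr_gt0.
have [d d0 Hd] := H _ e0.
pose s := Num.min r d / 2.
have s0 : 0 < s by rewrite divr_gt0 // lt_min r0.
have [sr sd] : s < r /\ s < d.
  have : Num.min r d <= r by rewrite ge_min lexx.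
  have : Num.min r d <= d by rewrite ge_min lexx orbT.
  by move: s0; rewrite /s; lra.
(* The first step from 0 has size at most C |x|, which [dl] keeps below s / 2. *)
pose C := (cnorm al + cnorm be / 2) / cnorm be.
have C0 : 0 < C by rewrite divr_gt0 // ltr_wpDl ?cnorm_ge0.
pose dl := Num.min d (s / 2 / C).
exists dl; first by rewrite lt_min d0 divr_gt0 // divr_gt0.
move=> x; rewrite lt_min ltr_pdivlMr // => /andP[xd xs].
pose T y := y - f (x, y) / be.
have z0 : cnorm (0 : Cx R) < d by rewrite cnorm0.
have T0 : cnorm (T 0) <= s / 2.
  rewrite /T sub0r cnormN cnormM cnormV ler_pdivrMr //.
  have := Hd (x, 0) (0, 0) xd z0 z0 z0.
  have -> : f (0, 0) = 0 by [].
  rewrite /= !subr0 mulr0 addr0 cnorm0 addr0 => k1.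
  have := cnormD (f (x, 0) - al * x) (al * x); rewrite subrK cnormM => k2.
  have : cnorm x * C * cnorm be <= s / 2 * cnorm be.
    by rewrite ler_wpM2r ?ltW.
  by rewrite -mulrA /C divfK ?gt_eqF //; lra.
have TL y y' : cnorm y < d -> cnorm y' < d ->
    cnorm (T y - T y') <= 2^-1 * cnorm (y - y').
  move=> hy hy'; have := Hd (x, y) (x, y') xd hy xd hy'.
  rewrite /= subrr mulr0 add0r cnorm0 add0r => k1.
  have -> : T y - T y' =
      - ((f (x, y) - f (x, y') - be * (y - y')) / be) by rewrite /T; field.
  rewrite cnormN cnormM cnormV ler_pdivrMr //.
  by apply: le_trans k1 _; rewrite le_eqVlt; apply/orP; left; apply/eqP; ring.
pose u n := iter n T 0.
(* The steps are at most s/2, s/4, and so on, so the iterates stay in the disc of radius s, where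
   the contraction estimate is available. *)
have Hu n : cnorm (u n) <= s * (1 - 2^-1 ^+ n) /\
            cnorm (u n.+1 - u n) <= s / 2 * 2^-1 ^+ n.
  elim: n => [|n [IH1 IH2]].
    by rewrite /u /= cnorm0 expr0 subrr mulr0 subr0 mulr1.
  have p0 : 0 <= (2^-1 : R) ^+ n by rewrite exprn_ge0.
  have Q1 : cnorm (u n.+1) <= s * (1 - 2^-1 ^+ n.+1).
    have := cnormD (u n.+1 - u n) (u n); rewrite subrK exprS.
    by move: IH1 IH2 p0; move: (2^-1 ^+ n) => q; nra.
  split => //.
  have lt k (hk : cnorm (u k) <= s * (1 - 2^-1 ^+ k)) : cnorm (u k) < d.
    apply: le_lt_trans hk _; apply: le_lt_trans sd.
    by rewrite ler_piMr ?(ltW s0) // gerBl exprn_ge0.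
  apply: le_trans (TL _ _ (lt _ Q1) (lt _ IH1)) _; rewrite exprS.
  by move: IH2; move: (2^-1 ^+ n) (cnorm _) => q c; lra.
have [y ul] := converges_fast (fun n => (Hu n).2).
have ys : cnorm y <= s.
  apply: (cvg_Cx_le (n0 := 0%N) ul) => n _; apply: le_trans (Hu n).1 _.
  by rewrite ler_piMr ?(ltW s0) // gerBl exprn_ge0.
exists y; first exact: le_lt_trans sr.
have yd : cnorm y < d by exact: le_lt_trans sd.
have Ty : T y = y.
  apply: (@cvg_Cx_unique R (fun n => u n.+1)); last exact: cvg_CxS.
  move=> e ee; have [n0 h0] := ul _ ee; exists n0 => n hn.
  have und : cnorm (u n) < d.
    apply: le_lt_trans (Hu n).1 _; apply: le_lt_trans sd.
    by rewrite ler_piMr ?(ltW s0) // gerBl exprn_ge0.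
  apply: le_lt_trans (TL _ _ und yd) _.
  by have := h0 n hn; have := cnorm_ge0 (u n - y); lra.
move: Ty; rewrite /T => /eqP; rewrite -subr_eq0 addrAC subrr sub0r oppr_eq0.
by rewrite mulf_eq0 invr_eq0 (negPf bn) orbF => /eqP.
Qed.

Lemma linearized_coef_unique f al be al' be' :
  linearized f al be -> linearized f al' be' -> al = al' /\ be = be'.
Proof.
have small (x : Cx R) : (forall e : R, 0 < e -> cnorm x <= 2 * e) -> x = 0.
  move=> h; apply/eqP; rewrite -cnorm_eq0 eq_le cnorm_ge0 andbT.
  apply/ler_addgt0Pr => e e0; rewrite add0r.
  have e2 : 0 < e / 2 by rewrite divr_gt0.
  by have := h _ e2; lra.
have key (f' : fgerm R) a b a' b' :
    linearized f' a b -> linearized f' a' b' -> a = a'.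
  move=> H H'; apply/eqP; rewrite -subr_eq0; apply/eqP; apply: small => e e0.
  have [d d0 Hd] := H _ e0; have [d' d'0 Hd'] := H' _ e0.
  pose r := Num.min d d' / 2.
  have r0 : 0 < r by rewrite divr_gt0 // lt_min d0.
  have [rd rd'] : r < d /\ r < d'.
    have : Num.min d d' <= d by rewrite ge_min lexx.
    have : Num.min d d' <= d' by rewrite ge_min lexx orbT.
    by move: r0; rewrite /r; lra.
  have [x xr] : exists x : Cx R, cnorm x = r.
    by exists (r%:C)%C; rewrite cnorm_real // ltW.
  have z0 : cnorm (0 : Cx R) = 0 by exact: cnorm0.
  have := Hd (x, 0) (0, 0); rewrite /= !subr0 mulr0 addr0 xr z0 addr0.
  move=> /(_ rd d0 d0 d0) k1.
  have := Hd' (x, 0) (0, 0); rewrite /= !subr0 mulr0 addr0 xr z0 addr0.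
  move=> /(_ rd' d'0 d'0 d'0) k2.
  rewrite -(ler_pM2r r0) -{1}xr -cnormM.
  have := cnormB (f' (x, 0) - f' (0, 0) - a' * x) (f' (x, 0) - f' (0, 0) - a * x).
  rewrite (_ : _ - _ - _ - _ = (a - a') * x); last by ring.
  lra.
move=> H H'; split; first exact: key H H'.
exact: key (linearized_swap2 H) (linearized_swap2 H').
Qed.

End ImplicitFunction.

(** * Closure properties of analytic germs, and the strict transform of a smooth germ *)

Section Analytic.
Variable R : realType.
Implicit Types (f g : fgerm R) (x y : Cx R) (z : C2 R) (d : option (Cx R)).

Lemma analytic_ext f g : (\forall z \near (0 : C2 R), f z = g z) ->
  analytic f -> analytic g.
Proof.
by move=> fg /analyticP[a ha]; apply/analyticP; exists a; exact: has_series_ext ha.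
Qed.

Lemma analyticM f g : analytic f -> analytic g -> analytic (fun z => f z * g z).
Proof.
move=> /analyticP[a ha] /analyticP[b hb]; apply/analyticP.
by eexists; exact: has_seriesM ha hb.
Qed.

Lemma analyticD f g : analytic f -> analytic g -> analytic (fun z => f z + g z).
Proof.
move=> /analyticP[a ha] /analyticP[b hb]; apply/analyticP.
by eexists; exact: has_seriesD ha hb.
Qed.

Lemma analytic_monomial x i j : analytic (fun z => x * z.1 ^+ i * z.2 ^+ j).
Proof. by apply/analyticP; eexists; exact: has_series_monomial. Qed.

Lemma analytic_cst x : analytic (fun _ : C2 R => x).
Proof.
apply: analytic_ext (analytic_monomial x 0 0); apply: near_C2W => z.
by rewrite !expr0 !mulr1.
Qed.

Lemma analyticX f n : analytic f -> analytic (fun z => f z ^+ n).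
Proof.
move=> fa; elim: n => [|n IH].
  by apply: analytic_ext (analytic_cst 1); apply: near_C2W => z; rewrite expr0.
by apply: analytic_ext (analyticM fa IH); apply: near_C2W => z; rewrite exprS.
Qed.

Lemma analytic_swap2 f : analytic f -> analytic (f \o @swap2 R).
Proof.
move=> /analyticP[a ha]; apply/analyticP; eexists; exact: has_series_swap2 ha.
Qed.

Lemma analytic_exc d : analytic (exc_eq d).
Proof.
case: d => [t|].
  apply: analytic_ext (analytic_monomial 1 1 0); apply: near_C2W => z.
  by rewrite expr0 expr1 mul1r mulr1.
apply: analytic_ext (analytic_monomial 1 0 1); apply: near_C2W => z.
by rewrite expr0 expr1 !mul1r.
Qed.

Lemma chart_None z : chart None z = swap2 (chart (Some 0) (swap2 z)).
Proof. by rewrite /swap2 /= addr0 mulrC. Qed.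

Lemma analytic_chart d f : analytic f -> analytic (f \o chart d).
Proof.
have some t g : analytic g -> analytic (g \o chart (Some t)).
  move=> /analyticP[a ha]; apply/analyticP; eexists; exact: has_series_chart ha.
case: d => [t|]; first exact: some.
move=> /analytic_swap2/(some 0)/analytic_swap2; apply: analytic_ext.
by apply: near_C2W => z; rewrite /= -chart_None.
Qed.

Lemma linearized_continuous f al be : linearized f al be ->
  forall e : R, 0 < e -> \forall z \near (0 : C2 R), cnorm (f z - f 0) < e.
Proof.
move=> /linearized_lipschitz[C C0 [d d0 H]] e e0; apply/near_C2P.
pose r := e / (2 * C).
have r0 : 0 < r by rewrite divr_gt0 // mulr_gt0.
exists (Num.min d r) => [|z]; first by rewrite lt_min d0.
rewrite !lt_min => /andP[z1 r1] /andP[z2 r2].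
have z0 : cnorm (0 : Cx R) < d by rewrite cnorm0.
have := H z (0, 0) z1 z2 z0 z0.
rewrite (_ : ((0, 0) : C2 R) = 0) // !subr0 => k.
apply: le_lt_trans k _; rewrite (_ : e = C * (r + r)); last first.
  by rewrite /r; field; rewrite gt_eqF.
by rewrite ltr_pM2l // ltrD.
Qed.

Lemma linearized_neq0 f al be : linearized f al be -> f 0 != 0 ->
  \forall z \near (0 : C2 R), f z != 0.
Proof.
rewrite -cnorm_gt0 => H f0; apply: filterS (linearized_continuous H f0) => z.
by apply: contraTneq => ->; rewrite sub0r cnormN ltxx.
Qed.

Lemma analytic_neq0 f : analytic f -> f 0 != 0 ->
  \forall z \near (0 : C2 R), f z != 0.
Proof. by move=> /analytic_linearized[al [be H]]; exact: linearized_neq0 H. Qed.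

Definition direction d : Cx R * Cx R := if d is Some t then (1, t) else (0, 1).

(* The last clause gives the derivative of [g] along the exceptional curve. *)
Lemma strict_transform d f al be : analytic f -> f 0 = 0 -> linearized f al be ->
  exists g, [/\ analytic g,
    \forall z \near (0 : C2 R), f (chart d z) = exc_eq d z * g z,
    g 0 = al * (direction d).1 + be * (direction d).2 &
    if d is Some _ then exists al', linearized g al' be
    else exists be', linearized g al be'].
Proof.
have some t f' a b : analytic f' -> f' 0 = 0 -> linearized f' a b ->
    exists g, [/\ analytic g,
    \forall z \near (0 : C2 R), f' (chart (Some t) z) = z.1 * g z,
    g 0 = a + b * t & exists a', linearized g a' b].
  move=> /analyticP[c hc] f0 hl.
  have c00 : c 0%N 0%N = 0 by rewrite -(has_series_at0 hc).
  have [-> ->] := linearized_coef_unique hl (has_series_linearized hc).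
  have cc0 k : chart_coef t c 0%N k = 0.
    by rewrite /chart_coef big_ord1 c00 mul0r.
  (* The coefficient of z.1 is the linear part of f' at (1, z.2 + t), of degree at most one in z.2;
     its constant term is the value of the quotient at 0. *)
  have cc1 k : (1 < k)%N -> chart_coef t c 1%N k = 0.
    move=> k1; rewrite /chart_coef big1 // => j _.
    by rewrite bin_small ?mul0r ?mulr0 //; apply: leq_ltn_trans k1; rewrite -ltnS.
  have [g [hg fg]] := has_series_div (has_series_chart t hc) cc0 cc1.
  exists g; split.
  - by apply/analyticP; eexists; exact: hg.
  - exact: fg.
  - rewrite (has_series_at0 hg) /chart_coef big_ord_recl big_ord1 /=.
    by rewrite !subn0 !subnn !bin0 !expr0 expr1 mulr1 mul1r mulr1.
  - eexists; have := has_series_linearized hg.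
    rewrite [X in linearized _ _ X]/chart_coef big_ord_recl big_ord1 /=.
    by rewrite subnn bin0n binn expr0 mul0r mulr0 mul1r mulr1 add0r; exact.
case: d => [t|] fa f0 hl.
  by have [g [h1 h2 h3 h4]] := some t f al be fa f0 hl; exists g; rewrite /= mulr1.
have f0' : (f \o @swap2 R) 0 = 0 by exact: f0.
have [g [h1 h2 h3 [a h4]]] := some 0 _ be al (analytic_swap2 fa) f0'
  (linearized_swap2 hl).
exists (g \o @swap2 R); split.
- exact: analytic_swap2.
- by apply: filterS (near_swap2 h2) => z; rewrite chart_None.
- by rewrite /= mulr0 mulr1 add0r -[LHS]/(g 0) h3 mulr0 addr0.
- by exists a; exact: linearized_swap2.
Qed.

Lemma derive_linearized f al be (v : C2 R) : linearized f al be ->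
  cnorm v.1 <= 1 -> cnorm v.2 <= 1 -> 'D_v f 0 = al * v.1 + be * v.2.
Proof.
move=> H v1 v2; rewrite /derive; apply: cvg_lim; first exact: norm_hausdorff.
apply/cvgrPdist_le => e e0; have [r r0 ->] := Cx_gt0P e0.
have r2 : 0 < r / 2 by rewrite divr_gt0.
have [d d0 Hd] := H _ r2.
apply: (@nbhs_norm0P _ (Cx R) _).2; exists (d%:C)%C; first by rewrite /= ltcR.
move=> t /=; rewrite norm_cnorm ltcR => td t0; rewrite norm_cnorm lecR.
have -> : t *: v + 0 = (t * v.1, t * v.2) by rewrite addr0.
have z0 : cnorm (0 : Cx R) < d by rewrite cnorm0.
have small x : cnorm x <= 1 -> cnorm (t * x) <= cnorm t.
  by move=> x1; rewrite cnormM ler_piMr ?cnorm_ge0.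
have h1 := small _ v1; have h2 := small _ v2.
have := Hd (t * v.1, t * v.2) (0, 0) (le_lt_trans h1 td) (le_lt_trans h2 td) z0 z0.
rewrite (_ : ((0, 0) : C2 R) = 0) // /= !subr0 => k.
have -> : al * v.1 + be * v.2 - t^-1 *: (f (t * v.1, t * v.2) - f 0) =
  - ((f (t * v.1, t * v.2) - f 0 - (al * (t * v.1) + be * (t * v.2))) / t).
  by rewrite -[t^-1 *: _]/(t^-1 * _); field.
rewrite cnormN cnormM cnormV ler_pdivrMr ?cnorm_gt0 //.
apply: le_trans k _; have -> : r * cnorm t = r / 2 * (cnorm t + cnorm t) by field.
by rewrite ler_pM2l // lerD.
Qed.

End Analytic.

(** * Jacobians of compositions of charts *)

Section Jacobian.
Variable R : realType.
Implicit Types (f g : fgerm R) (x y : Cx R) (z v : C2 R) (d : option (Cx R)).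
Implicit Types (s P Q : inf_near R).

Lemma is_derive_coord (f : C2 R -> Cx R) z v :
  (forall (t : Cx R) (p : C2 R), f (t *: v + p) = t * f v + f p) ->
  is_derive z v f (f v).
Proof.
move=> H.
have cv : (fun h : Cx R => h^-1 *: ((f \o shift z) (h *: v) - f z)) @ 0^' --> f v.
  apply/cvgrPdist_le => e e0.
  apply: (@nbhs_norm0P _ (Cx R) _).2; exists 1; first exact: ltr01.
  move=> t _ t0 /=; rewrite H addrK.
  have -> : t^-1 *: (t * f v) = f v by rewrite -[LHS]/(t^-1 * (t * f v)) mulKf.
  by rewrite subrr normr0 ltW.
apply: DeriveDef; first by apply/cvg_ex; exists (f v).
by rewrite /derive; apply: cvg_lim cv; exact: norm_hausdorff.
Qed.

Lemma is_derive_chart d s z v (a b : Cx R) :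
  is_derive z v (fun p => (blowdown s p).1) a ->
  is_derive z v (fun p => (blowdown s p).2) b ->
  is_derive z v (fun p => (blowdown (d :: s) p).1)
    (if d is Some _ then a else (blowdown s z).1 * b + (blowdown s z).2 * a) /\
  is_derive z v (fun p => (blowdown (d :: s) p).2)
    (if d is Some t then (blowdown s z).1 * b + ((blowdown s z).2 + t) * a else b).
Proof.
move=> ha hb; case: d => [t|]; split=> //; last exact: (is_deriveM ha hb).
have hc : is_derive z v ((fun p => (blowdown s p).2) + cst t) (b + 0).
  exact: is_deriveD.
rewrite -[b]addr0; exact: (is_deriveM ha hc).
Qed.

Lemma is_derive_blowdown s z v : exists a b,
  is_derive z v (fun p => (blowdown s p).1) a /\
  is_derive z v (fun p => (blowdown s p).2) b.
Proof.
elim: s => [|d s [a [b [ha hb]]]].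
  by exists v.1, v.2; split; exact: is_derive_coord.
by do 2 eexists; exact: is_derive_chart ha hb.
Qed.

Lemma jacE (F : C2 R -> C2 R) z (a1 b1 a2 b2 : Cx R) :
  is_derive z ((1, 0) : C2 R) (fun p => (F p).1) a1 ->
  is_derive z ((1, 0) : C2 R) (fun p => (F p).2) b1 ->
  is_derive z ((0, 1) : C2 R) (fun p => (F p).1) a2 ->
  is_derive z ((0, 1) : C2 R) (fun p => (F p).2) b2 ->
  jac F z = a1 * b2 - a2 * b1.
Proof.
move=> h1 h2 h3 h4.
by rewrite /jac (derive_val (is_derive := h1)) (derive_val (is_derive := h2))
  (derive_val (is_derive := h3)) (derive_val (is_derive := h4)).
Qed.

Lemma jac_cons d s z :
  jac (blowdown (d :: s)) z = exc_eq d (blowdown s z) * jac (blowdown s) z.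
Proof.
have [a1 [b1 [ha1 hb1]]] := is_derive_blowdown s z (1, 0).
have [a2 [b2 [ha2 hb2]]] := is_derive_blowdown s z (0, 1).
have [k1 k2] := is_derive_chart d ha1 hb1.
have [k3 k4] := is_derive_chart d ha2 hb2.
rewrite (jacE k1 k2 k3 k4) (jacE ha1 hb1 ha2 hb2).
by case: d {k1 k2 k3 k4} => [t|] /=; ring.
Qed.

Lemma jac_nil z : jac (blowdown [::]) z = 1.
Proof.
have h1 v : is_derive z v (fun p => (blowdown [::] p).1) v.1.
  exact: is_derive_coord.
have h2 v : is_derive z v (fun p => (blowdown [::] p).2) v.2.
  exact: is_derive_coord.
by rewrite (jacE (h1 _) (h2 _) (h1 _) (h2 _)) /= mulr1 mulr0 subr0.
Qed.

Lemma blowdown_rcons s d z : blowdown (rcons s d) z = blowdown s (chart d z).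
Proof. by elim: s => //= e s ->. Qed.

Lemma blowdown_cat s s' z : blowdown (s ++ s') z = blowdown s (blowdown s' z).
Proof. by elim: s => //= e s ->. Qed.

(** The recursion of [blowdown] peels off the chart nearest to O, while points are added to a
    constellation at the other end; this is the chain rule for that other end. *)
Lemma jac_rcons s d z :
  jac (blowdown (rcons s d)) z = jac (blowdown s) (chart d z) * exc_eq d z.
Proof.
elim: s => [|e s IH].
  by rewrite [rcons _ _]/= jac_cons !jac_nil mul1r mulr1.
by rewrite rcons_cons !jac_cons IH blowdown_rcons mulrA.
Qed.

Lemma chart_eq0 d z : (exc_eq d z = 0) <-> (chart d z = 0).
Proof.
case: d => [t|] /=; split.
- by move=> ->; rewrite mul0r.
- by case.
- by move=> ->; rewrite mulr0.
- by case.
Qed.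

Lemma chart0 d : chart d (0 : C2 R) = 0.
Proof. by apply/chart_eq0; case: d. Qed.

Lemma blowdown0 s : blowdown s (0 : C2 R) = 0.
Proof. by elim: s => //= d s ->; exact: chart0. Qed.

(** Outside the exceptional divisor the map is a local isomorphism; hence the pulled-back 2-form
    vanishes only on what is contracted to O. *)
Lemma jac_blowdown_eq0 s z : jac (blowdown s) z = 0 -> blowdown s z = 0.
Proof.
elim: s => [|d s IH]; first by rewrite jac_nil => /eqP; rewrite oner_eq0.
rewrite jac_cons => /eqP; rewrite mulf_eq0 => /orP[/eqP/chart_eq0 //|/eqP/IH] /= ->.
exact: chart0.
Qed.

Lemma near_blowdown s (A : C2 R -> Prop) : (\forall z \near (0 : C2 R), A z) ->
  \forall z \near (0 : C2 R), A (blowdown s z).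
Proof.
elim: s A => [|d s IH] A hA; first exact: hA.
exact: IH _ (near_chart d hA).
Qed.

Lemma analytic_blowdown s f : analytic f -> analytic (f \o blowdown s).
Proof.
elim: s f => [|d s IH] f fa.
  by apply: analytic_ext fa; apply: near_C2W.
by apply: analytic_ext (IH _ (analytic_chart d fa)); apply: near_C2W.
Qed.

Lemma analytic_jac_blowdown s : analytic (jac (blowdown s) : fgerm R).
Proof.
elim: s => [|d s IH].
  apply: analytic_ext (analytic_cst 1); apply: near_C2W => z.
  by rewrite jac_nil.
apply: analytic_ext (analyticM (analytic_blowdown s (analytic_exc d)) IH).
by apply: near_C2W => z; rewrite jac_cons.
Qed.

Lemma proj_nil Q : proj [::] Q = @blowdown R Q.
Proof. by rewrite /proj drop0. Qed.

Lemma proj_id Q z : proj Q Q z = z.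
Proof. by rewrite /proj drop_size. Qed.

Lemma proj_cat P s : proj P (P ++ s) = @blowdown R s.
Proof. by rewrite /proj drop_size_cat. Qed.

Lemma proj_rcons P Q d z : prefix P Q -> proj P (rcons Q d) z = proj P Q (chart d z).
Proof.
by case/prefixP => s ->; rewrite rcons_cat !proj_cat blowdown_rcons.
Qed.

Lemma proj_last P d z : proj P (rcons P d) z = chart d z.
Proof. by rewrite proj_rcons ?prefix_refl // proj_id. Qed.

Lemma proj_comp P Q Q' z : prefix P Q -> prefix Q Q' ->
  proj P Q' z = proj P Q (proj Q Q' z).
Proof.
case/prefixP => s ->; case/prefixP => s' ->.
by rewrite -catA !proj_cat catA proj_cat blowdown_cat.
Qed.

Lemma proj0 P Q : proj P Q (0 : C2 R) = 0.
Proof. exact: blowdown0. Qed.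

Lemma near_proj P Q (A : C2 R -> Prop) : (\forall z \near (0 : C2 R), A z) ->
  \forall z \near (0 : C2 R), A (proj P Q z).
Proof. exact: near_blowdown. Qed.

End Jacobian.

(** * Germs of crosses and their strict transforms *)

Definition germ_eq (R : realType) (A B : set (C2 R)) : Prop :=
  germ_sub A B /\ germ_sub B A.

Local Opaque analytic linearized.

Section Germs.
Variable R : realType.
Implicit Types (f g h u : fgerm R) (x y : Cx R) (z : C2 R) (d : option (Cx R)).
Implicit Types (A B C : set (C2 R)).

Lemma near_C2S (P Q : C2 R -> Prop) : (forall z, P z -> Q z) ->
  (\forall z \near (0 : C2 R), P z) -> \forall z \near (0 : C2 R), Q z.
Proof. by move=> PQ; apply: filterS. Qed.

Lemma near_C2I (P Q : C2 R -> Prop) : (\forall z \near (0 : C2 R), P z) ->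
  (\forall z \near (0 : C2 R), Q z) -> \forall z \near (0 : C2 R), P z /\ Q z.
Proof. by move=> hP hQ; apply: filterS2 hP hQ. Qed.

Lemma germ_sub_refl A : germ_sub A A.
Proof. exact: near_C2W. Qed.

Lemma germ_sub_trans A B C : germ_sub A B -> germ_sub B C -> germ_sub A C.
Proof. by move=> ab bc; apply: near_C2S (near_C2I ab bc) => z [h k] /h/k. Qed.

Lemma germ_sub_or A A' B B' : germ_sub A B -> germ_sub A' B' ->
  germ_sub (A `|` A') (B `|` B').
Proof.
by move=> h h'; apply: near_C2S (near_C2I h h') => z [k k'] [/k|/k']; [left|right].
Qed.

Lemma germ_eq_refl A : germ_eq A A.
Proof. by split; exact: germ_sub_refl. Qed.

Lemma germ_eq_sym A B : germ_eq A B -> germ_eq B A.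
Proof. by case. Qed.

Lemma jac_linearized f g a b c e : linearized f a b -> linearized g c e ->
  jac (fun z => (f z, g z)) 0 = a * e - b * c.
Proof.
move=> h1 h2; rewrite /jac /=.
have c0 : cnorm (0 : Cx R) <= 1 by rewrite cnorm0.
have c1 : cnorm (1 : Cx R) <= 1 by rewrite cnorm1.
rewrite (derive_linearized (v := (1, 0)) h1 c1 c0).
rewrite (derive_linearized (v := (0, 1)) h1 c0 c1).
rewrite (derive_linearized (v := (1, 0)) h2 c1 c0).
rewrite (derive_linearized (v := (0, 1)) h2 c0 c1) /=.
by rewrite !mulr1 !mulr0 !addr0 !add0r.
Qed.

Lemma cross_intro f g a b c e : analytic f -> analytic g -> f 0 = 0 -> g 0 = 0 ->
  linearized f a b -> linearized g c e -> a * e - b * c != 0 -> cross (f, g).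
Proof.
move=> fa ga f0 g0 h1 h2 j; split; [exact (conj fa ga) | exact (conj f0 g0) |].
by rewrite -(jac_linearized h1 h2) in j.
Qed.

Lemma cross_elim f g : cross (f, g) ->
  [/\ analytic f, analytic g, f 0 = 0, g 0 = 0 &
    exists a b c e, [/\ linearized f a b, linearized g c e & a * e - b * c != 0]].
Proof.
move=> [[/= fa ga] [f0 g0] j].
have [a [b h1]] := analytic_linearized fa.
have [c [e h2]] := analytic_linearized ga.
split; [exact: fa | exact: ga | exact: f0 | exact: g0 |].
exists a, b, c, e; split; [exact: h1 | exact: h2 |].
by rewrite -(jac_linearized h1 h2).
Qed.

Lemma cross_sym f g : cross (f, g) -> cross (g, f).
Proof.
move=> /cross_elim[fa ga f0 g0 [a [b [c [e [h1 h2 j]]]]]].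
apply: (cross_intro ga fa g0 f0 h2 h1).
by rewrite -oppr_eq0 opprB (mulrC e) (mulrC c).
Qed.

Lemma cross_swap2 f g : cross (f, g) -> cross (f \o @swap2 R, g \o @swap2 R).
Proof.
move=> /cross_elim[fa ga f0 g0 [a [b [c [e [h1 h2 j]]]]]].
apply: (cross_intro (analytic_swap2 fa) (analytic_swap2 ga) _ _
  (linearized_swap2 h1) (linearized_swap2 h2)); [exact: f0 | exact: g0 |].
by rewrite -oppr_eq0 opprB.
Qed.

Lemma linearized_at0 f a b : linearized f a b -> f 0 = 0 ->
  forall e : R, 0 < e -> \forall z \near (0 : C2 R),
    cnorm (f z - (a * z.1 + b * z.2)) <= e * (cnorm z.1 + cnorm z.2).
Proof.
move=> H f0 e e0; have [r r0 Hr] := H _ e0; apply/near_C2P; exists r => // z h1 h2.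
have z0 : cnorm (0 : Cx R) < r by rewrite cnorm0.
have := Hr z (0, 0) h1 h2 z0 z0.
by rewrite (_ : ((0, 0) : C2 R) = 0) // f0 !subr0.
Qed.

(** By Cramer's rule z is recovered from the linear parts, which at a common zero reduce to error
    terms much smaller than z. *)
Lemma cross_injective0 f g : cross (f, g) ->
  \forall z \near (0 : C2 R), f z = 0 -> g z = 0 -> z = 0.
Proof.
move=> /cross_elim[_ _ f0 g0 [a [b [c [d [hf hg j]]]]]].
pose D := a * d - b * c; rewrite -/D in j.
pose B := cnorm a + cnorm b + cnorm c + cnorm d.
have B0 : 0 <= B by rewrite !addr_ge0 ?cnorm_ge0.
have D0 : 0 < cnorm D by rewrite cnorm_gt0.
(* The errors enter Cramer's formulas with total weight [B], so they account for at most half of |D|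
   (|z1| + |z2|). *)
have e0 : 0 < cnorm D / (2 * (B + 1)) by rewrite divr_gt0 // mulr_gt0 // ltr_wpDl.
apply: filterS2 (linearized_at0 hf f0 e0) (linearized_at0 hg g0 e0) => z kf kg fz gz.
move: kf kg; rewrite fz gz !sub0r !cnormN.
set S := cnorm z.1 + cnorm z.2; set p := a * z.1 + _; set q := c * z.1 + _.
move=> kf kg.
have E1 : D * z.1 = d * p - b * q by rewrite /D /p /q; ring.
have E2 : D * z.2 = a * q - c * p by rewrite /D /p /q; ring.
have N1 : cnorm D * cnorm z.1 <= cnorm d * cnorm p + cnorm b * cnorm q.
  by rewrite -!cnormM E1 cnormB.
have N2 : cnorm D * cnorm z.2 <= cnorm a * cnorm q + cnorm c * cnorm p.
  by rewrite -!cnormM E2 cnormB.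
have S0 : 0 <= S by rewrite addr_ge0 ?cnorm_ge0.
have N : cnorm D * S <= B * (cnorm D / (2 * (B + 1)) * S).
  rewrite /S mulrDr; apply: le_trans (lerD N1 N2) _; rewrite -/S.
  have := ler_wpM2l (cnorm_ge0 a) kg; have := ler_wpM2l (cnorm_ge0 b) kg.
  have := ler_wpM2l (cnorm_ge0 c) kf; have := ler_wpM2l (cnorm_ge0 d) kf.
  rewrite /B !mulrDl; lra.
have : B * (cnorm D / (2 * (B + 1)) * S) <= 2^-1 * (cnorm D * S).
  have -> : B * (cnorm D / (2 * (B + 1)) * S) =
            (B / (B + 1)) * (2^-1 * (cnorm D * S)).
    by field; rewrite gt_eqF // ltr_wpDl.
  rewrite ler_piMl ?mulr_ge0 ?(ltW D0) // ler_pdivrMr ?ltr_wpDl // mul1r lerDl //.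
move=> N'; have DS : cnorm D * S <= 0 by move: N N'; lra.
have S1 : S <= 0 by rewrite -(pmulr_rle0 _ D0).
have [n1 n2] := (cnorm_ge0 z.1, cnorm_ge0 z.2).
have z1 : z.1 = 0 by apply/eqP; rewrite -cnorm_eq0; apply/eqP; rewrite /S in S1; lra.
have z2 : z.2 = 0 by apply/eqP; rewrite -cnorm_eq0; apply/eqP; rewrite /S in S1; lra.
by case: z z1 z2 {S p q kf kg E1 E2 N1 N2 S0 N N' DS S1 n1 n2 fz gz} => z1 z2 /= -> ->.
Qed.

Lemma near_small_real (r : R) : 0 < r -> exists2 x : Cx R, x != 0 & cnorm x < r.
Proof.
move=> r0; have r2 : 0 < r / 2 by rewrite divr_gt0.
have xr : cnorm ((((r / 2)%:C)%C) : Cx R) = r / 2 by rewrite cnorm_real // ltW.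
by exists ((r / 2)%:C)%C; [rewrite -cnorm_gt0 xr | rewrite xr; lra].
Qed.

(** The zero set contains a point over each small point of one of the axes. *)
Lemma linearized_nontrivial f a b : linearized f a b -> f 0 = 0 ->
  (a, b) != (0, 0) -> ~ germ_sub (zeros f) [set z | z = 0].
Proof.
have key g (p q : Cx R) : linearized g p q -> g 0 = 0 -> q != 0 ->
    ~ germ_sub (zeros g) [set z | z = 0].
  move=> H g0 q0 /near_C2P[r r0 Hr].
  have [s s0 Hs] := linearized_solve H q0 g0 r0.
  have [x x0] : exists2 x : Cx R, x != 0 & cnorm x < Num.min r s.
    by apply: near_small_real; rewrite lt_min r0.
  rewrite lt_min => /andP[xr xs]; have [y yr gy] := Hs _ xs.
  by have [/eqP] := Hr (x, y) xr yr gy; rewrite (negPf x0).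
move=> H f0; have [-> |b0 _] := eqVneq b 0; last exact: key H f0 b0.
rewrite xpair_eqE eqxx andbT => a0 sub.
apply: (key _ _ _ (linearized_swap2 H) f0 a0).
apply: near_C2S (near_swap2 sub) => -[z1 z2] k h.
by case: (k h) => -> ->.
Qed.

Lemma cross_nontrivial f g : cross (f, g) -> ~ germ_sub (zeros f) [set z | z = 0].
Proof.
move=> /cross_elim[_ _ f0 _ [a [b [c [d [hf _ j]]]]]].
apply: linearized_nontrivial hf f0 _; apply: contraNneq j => -[-> ->].
by rewrite !mul0r subrr.
Qed.

Lemma linearized_exc d : linearized (exc_eq d)
  (if d is Some _ then 1 else 0) (if d is Some _ then 0 else 1).
Proof.
move=> e e0; exists 1 => // z z' _ _ _ _.
have -> : exc_eq d z - exc_eq d z' - ((if d is Some _ then 1 else 0) * (z.1 - z'.1) +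
    (if d is Some _ then 0 else 1) * (z.2 - z'.2)) = 0.
  by case: d => [t|] /=; ring.
by rewrite cnorm0 mulr_ge0 ?(ltW e0) // addr_ge0 ?cnorm_ge0.
Qed.

Lemma exc0 d : exc_eq d (0 : C2 R) = 0.
Proof. by case: d. Qed.

Lemma cross_exc d g a b : analytic g -> g 0 = 0 -> linearized g a b ->
  (if d is Some _ then b else a) != 0 -> cross (exc_eq d, g).
Proof.
move=> ga g0 hg ne.
apply: (cross_intro (analytic_exc d) ga (exc0 d) g0 (linearized_exc d) hg).
by case: d ne => [t|]; rewrite !mul1r !mul0r ?subr0 // sub0r oppr_eq0.
Qed.

Lemma exc_cross_coef d g a b : cross (exc_eq d, g) -> linearized g a b ->
  (if d is Some _ then b else a) != 0.
Proof.
move=> /cross_elim[_ _ _ _ [a1 [b1 [a2 [b2 [h1 h2 j]]]]]] hg.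
have [E1 E2] := linearized_coef_unique h1 (linearized_exc d).
have [E3 E4] := linearized_coef_unique h2 hg.
move: j; rewrite E1 E2 E3 E4; case: d {h1 E1 E2} => [t|].
  by rewrite mul1r mul0r subr0.
by rewrite mul0r mul1r sub0r oppr_eq0.
Qed.

(* Two smooth germs transversal to the exceptional curve are graphs over it, so
   that an inclusion outside of it is an equality. *)
Lemma same_branch d g h : cross (exc_eq d, g) -> cross (exc_eq d, h) ->
  germ_sub (zeros g) (zeros (exc_eq d) `|` zeros h) ->
  germ_sub (zeros h) (zeros g).
Proof.
have some t u v : cross (exc_eq (Some t), u) -> cross (exc_eq (Some t), v) ->
    germ_sub (zeros u) (zeros (exc_eq (Some t)) `|` zeros v) ->
    germ_sub (zeros v) (zeros u).
  move=> cu cv /near_C2P[r r0 Hr].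
  have [_ ua _ u0 _] := cross_elim cu; have [_ va _ v0 _] := cross_elim cv.
  have [a [b hu]] := analytic_linearized ua.
  have [a' [b' hv]] := analytic_linearized va.
  have bu := exc_cross_coef cu hu; have bv := exc_cross_coef cv hv.
  have [s s0 Hs] := linearized_unique hv bv.
  have rs : 0 < Num.min r s by rewrite lt_min r0.
  have [q q0 Hq] := linearized_solve hu bu u0 rs.
  have [k k0 Hk] := (near_C2P _).1 (cross_injective0 cv).
  apply/near_C2P; exists (Num.min (Num.min r s) (Num.min q k)).
    by rewrite !lt_min r0 s0 q0 k0.
  move=> [z1 z2] /=; rewrite !lt_min.
  move=> /andP[/andP[r1 s1] /andP[q1 k1]] /andP[/andP[r2 s2] /andP[q2 k2]] vz.
  (* On the exceptional curve the inclusion says nothing, but there v vanishes only at 0. Elsewhere,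
     the point w of u = 0 over z1 lies on v = 0, and equals z2 by uniqueness. *)
  have [z10|z10] := eqVneq z1 0.
    by rewrite (Hk (z1, z2) k1 k2 z10 vz) /zeros /= u0.
  have [w] := Hq z1 q1; rewrite lt_min => /andP[wr ws] uw.
  case: (Hr (z1, w) r1 wr uw) => [/= /eqP|vw]; first by rewrite /zeros /= (negPf z10).
  by rewrite /zeros /= (Hs z1 z2 w s1 s2 ws vz vw).
case: d => [t|]; first exact: some.
move=> cg ch /near_swap2 H.
have := near_swap2 (some 0 _ _ (cross_swap2 cg) (cross_swap2 ch) H).
by apply: filterS => -[z1 z2].
Qed.

(** A branch transversal to the exceptional curve meets it only at 0, so both cannot be transversal.
    If one is tangent, the other is transversal, so the tangent one vanishes on the whole
    exceptional curve; being a graph over that curve, it coincides with it. *)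
Lemma exc_branch d (p : fgerm R * fgerm R) : cross p ->
  germ_sub (zeros (exc_eq d)) (cross_set p) ->
  (germ_eq (zeros p.1) (zeros (exc_eq d)) /\ cross (exc_eq d, p.2)) \/
  (germ_eq (zeros p.2) (zeros (exc_eq d)) /\ cross (exc_eq d, p.1)).
Proof.
have half t f g a : cross (f, g) -> linearized f a 0 ->
    germ_sub (zeros (exc_eq (Some t))) (zeros f `|` zeros g) ->
    germ_eq (zeros f) (zeros (exc_eq (Some t))) /\ cross (exc_eq (Some t), g).
  move=> /cross_elim[fa ga f0 g0 [a1 [b1 [c [e [hf hg j]]]]]] hf0 sub.
  have [Ea Eb] := linearized_coef_unique hf hf0; rewrite Eb mul0r subr0 in j.
  move: j; rewrite mulf_eq0 negb_or => /andP[a0 e0].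
  have [s s0 Hs] := linearized_unique hg e0.
  have [r r0 Hr] := linearized_unique (linearized_swap2 hf) a0.
  have [k k0 Hk] := (near_C2P _).1 sub.
  have z0 (m : R) : 0 < m -> cnorm (0 : Cx R) < m by rewrite cnorm0.
  have ef (z2 : Cx R) : cnorm z2 < Num.min s k -> f (0, z2) = 0.
    rewrite lt_min => /andP[zs zk].
    case: (Hk (0, z2) (z0 _ k0) zk erefl) => // gz.
    by rewrite (Hs 0 z2 0 (z0 _ s0) zs (z0 _ s0) gz g0).
  split; last exact: (cross_exc (d := Some t) ga g0 hg).
  split; apply/near_C2P; exists (Num.min (Num.min s k) r);
    rewrite ?lt_min ?s0 ?k0 ?r0 //.
    move=> [z1 z2] /=; rewrite !lt_min -!lt_min.
    rewrite lt_min => /andP[_ z1r]; rewrite lt_min => /andP[zsk z2r] fz.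
    by apply: (Hr z2 z1 0 z2r z1r (z0 _ r0)); [exact: fz | exact: ef].
  move=> [z1 z2] _ /=; rewrite lt_min => /andP[zsk _]; rewrite /zeros /= => ->.
  exact: ef.
have some t f g : cross (f, g) ->
    germ_sub (zeros (exc_eq (Some t))) (zeros f `|` zeros g) ->
    (germ_eq (zeros f) (zeros (exc_eq (Some t))) /\ cross (exc_eq (Some t), g)) \/
    (germ_eq (zeros g) (zeros (exc_eq (Some t))) /\ cross (exc_eq (Some t), f)).
  move=> cfg sub.
  have [fa ga f0 g0 [a [b [a' [b' [hf hg j]]]]]] := cross_elim cfg.
  have [bf|bf] := eqVneq b 0.
    by left; rewrite bf in hf; exact: half cfg hf sub.
  have [bg|bg] := eqVneq b' 0.
    right; rewrite bg in hg; apply: half (cross_sym cfg) hg _.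
    by rewrite setUC.
  exfalso; have [s s0 Hs] := linearized_unique hf bf.
  have [r r0 Hr] := linearized_unique hg bg.
  have [k k0 Hk] := (near_C2P _).1 sub.
  have z0 (m : R) : 0 < m -> cnorm (0 : Cx R) < m by rewrite cnorm0.
  have [y y0] : exists2 y : Cx R, y != 0 & cnorm y < Num.min (Num.min s r) k.
    by apply: near_small_real; rewrite !lt_min s0 r0 k0.
  rewrite !lt_min => /andP[/andP[ys yr] yk]; move/eqP: y0; apply.
  case: (Hk (0, y) (z0 _ k0) yk erefl) => h.
    exact: (Hs 0 y 0 (z0 _ s0) ys (z0 _ s0) h f0).
  exact: (Hr 0 y 0 (z0 _ r0) yr (z0 _ r0) h g0).
case: p => f g; case: d => [t|] /=; first exact: some.
move=> cfg sub.
have sw A B : germ_sub (A \o @swap2 R) (B \o @swap2 R) -> germ_sub A B.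
  by move=> /near_swap2; apply: filterS => -[z1 z2].
have swx u : cross (exc_eq (Some 0), u \o @swap2 R) -> cross (exc_eq None, u).
  move=> c; have [_ ua _ u0 _] := cross_elim c.
  have ua' : analytic u.
    by apply: analytic_ext (analytic_swap2 ua); apply: near_C2W => -[z1 z2].
  have [a [b hu]] := analytic_linearized ua'.
  apply: (cross_exc (d := None) ua' u0 hu).
  exact: (exc_cross_coef c (linearized_swap2 hu)).
have := some 0 _ _ (cross_swap2 cfg) (near_swap2 sub).
by case=> -[[s1 s2] c]; [left | right]; (split; last exact: swx);
  split; apply: sw.
Qed.

End Germs.

(** * Blowing up a cross, and orders of vanishing along the exceptional curve *)

Section StrictTransforms.
Variable R : realType.
Implicit Types (f g h u : fgerm R) (x y : Cx R) (z : C2 R) (d : option (Cx R)).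
Implicit Types (A B C : set (C2 R)).

(* The last clause says that the branch [u = 0] is covered by its strict
   transform. *)
Definition strict_transform_of d u g : Prop :=
  [/\ analytic g,
      \forall z \near (0 : C2 R), u (chart d z) = exc_eq d z * g z,
      g 0 = 0 -> cross (exc_eq d, g) &
      g 0 = 0 -> forall A, A 0 ->
        (\forall z \near (0 : C2 R), g z = 0 -> A (chart d z)) ->
        \forall z \near (0 : C2 R), u z = 0 -> A z].

(** The branch is tangent to the direction of slope t, so a point (y1, y2) of it close to 0 lifts to
    (y1, y2 / y1 - t), which is also close to 0 and lies on g = 0. *)
Lemma lift_branch_Some t u a b g A : linearized u a b -> u 0 = 0 ->
  (a, b) != (0, 0) ->
  (\forall z \near (0 : C2 R), u (chart (Some t) z) = z.1 * g z) ->
  a + b * t = 0 -> A 0 ->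
  (\forall z \near (0 : C2 R), g z = 0 -> A (chart (Some t) z)) ->
  \forall z \near (0 : C2 R), u z = 0 -> A z.
Proof.
move=> hu u0 ab ug abt A0 gA.
have b0 : b != 0.
  apply: contraNneq ab => b0; move: abt; rewrite b0 mul0r addr0 => ->.
  by rewrite eqxx.
have {}b0 : 0 < cnorm b by rewrite cnorm_gt0.
have [r r0 Hr] := (near_C2P _).1 (near_C2I ug gA).
have t0 := cnorm_ge0 t.
(* The first bound lets |b w| absorb the error proportional to w, and forces y2 = 0 when y1 = 0; the
   second then gives |w| <= r / 2. *)
pose e := Num.min (cnorm b / 2) (cnorm b * r / (4 * (1 + cnorm t))).
have e0 : 0 < e.
  rewrite lt_min divr_gt0 //= divr_gt0 // mulr_gt0 //; lra.
have eb : e <= cnorm b / 2 by rewrite ge_min lexx.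
have er : e * (4 * (1 + cnorm t)) <= cnorm b * r.
  by rewrite -ler_pdivlMr ?ge_min ?lexx ?orbT //; lra.
apply: near_C2S (near_C2I (near_small r0) (linearized_at0 hu u0 e0)).
move=> [y1 y2] /= [[h1 h2] k] uy; rewrite uy sub0r cnormN in k.
have Ea : a = - (b * t) by apply/eqP; rewrite -addr_eq0 abt.
have [y10|y10] := eqVneq y1 0.
  move: k; rewrite y10 mulr0 add0r cnorm0 add0r cnormM => k.
  have : cnorm y2 <= 0 by have := cnorm_ge0 y2; nra.
  rewrite le_eqVlt ltNge cnorm_ge0 orbF cnorm_eq0 => /eqP ->; exact: A0.
pose w := y2 / y1 - t.
have Ey : y2 = y1 * (w + t) by rewrite /w; field.
have n1 : 0 < cnorm y1 by rewrite cnorm_gt0.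
have kw : cnorm b * cnorm w <= e * (1 + cnorm w + cnorm t).
  rewrite -(ler_pM2r n1) -!cnormM.
  have -> : b * w * y1 = a * y1 + b * y2 by rewrite Ey Ea; ring.
  apply: le_trans k _; rewrite -mulrA ler_pM2l // Ey cnormM.
  have := cnormD w t; nra.
have wr : cnorm w < r.
  have k1 : cnorm w * (cnorm b / 2) <= e * (1 + cnorm t).
    have := cnorm_ge0 w; nra.
  by rewrite -(ltr_pM2r b0); nra.
have Ec : chart (Some t) (y1, w) = (y1, y2) by rewrite /= -Ey.
have [ku kA] := Hr (y1, w) h1 wr; rewrite Ec /= uy in ku kA.
apply: kA; apply: (mulfI y10); rewrite mulr0; exact/esym.
Qed.

(** The strict transform passes through d exactly when the linear part vanishes in that direction.
    The derivative of [g] along the exceptional curve is then the other coefficient, nonzero since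
    the linear part is, whence transversality. *)
Lemma blow_up_branch d u a b : analytic u -> u 0 = 0 -> linearized u a b ->
  (a, b) != (0, 0) -> exists2 g, strict_transform_of d u g &
    g 0 = a * (direction d).1 + b * (direction d).2.
Proof.
move=> ua u0 hu ab; have [g [ga ug g0 gl]] := strict_transform d ua u0 hu.
exists g; last exact: g0.
split; [exact: ga | exact: ug | |].
  move=> g00; rewrite g00 in g0; case: d ug g0 gl => [t|] ug /= /esym g0 [c gl].
    apply: (cross_exc (d := Some t) ga g00 gl).
    apply: contraNneq ab => b0; move: g0; rewrite b0 mul0r addr0 mulr1 => ->.
    by rewrite eqxx.
  apply: (cross_exc (d := None) ga g00 gl).
  apply: contraNneq ab => a0; move: g0; rewrite a0 mul0r add0r mulr1 => ->.
  by rewrite eqxx.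
move=> g00 A A0 gA; rewrite g00 in g0; case: d ug g0 gl gA => [t|] ug /esym g0 [c gl] gA.
  rewrite /= mulr1 in g0; exact: (lift_branch_Some hu u0 ab ug g0 A0 gA).
rewrite /= mulr0 add0r mulr1 in g0.
have ba : (b, a) != (0, 0).
  by apply: contraNneq ab => -[-> ->]; rewrite eqxx.
have ug' : \forall z \near (0 : C2 R),
    (u \o @swap2 R) (chart (Some 0) z) = z.1 * (g \o @swap2 R) z.
  by apply: near_C2S (near_swap2 ug) => -[z1 z2]; rewrite chart_None.
have gA' : \forall z \near (0 : C2 R), (g \o @swap2 R) z = 0 ->
    (A \o @swap2 R) (chart (Some 0) z).
  by apply: near_C2S (near_swap2 gA) => -[z1 z2]; rewrite chart_None.
have ba0 : b + a * 0 = 0 by rewrite g0 mulr0 addr0.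
have := lift_branch_Some (linearized_swap2 hu) u0 ba ug' ba0 A0 gA'.
by move/near_swap2; apply: near_C2S => -[z1 z2].
Qed.

(** The two branches have distinct tangents, so at most one strict transform passes through d. *)
Lemma blow_up_cross d u v : cross (u, v) -> exists g h,
  [/\ strict_transform_of d u g, strict_transform_of d v h &
      g 0 != 0 \/ h 0 != 0].
Proof.
move=> /cross_elim[ua va u0 v0 [a [b [a' [b' [hu hv j]]]]]].
have ab : (a, b) != (0, 0).
  by apply: contraNneq j => -[-> ->]; rewrite !mul0r subrr.
have ab' : (a', b') != (0, 0).
  by apply: contraNneq j => -[-> ->]; rewrite !mulr0 subrr.
have [g hg g0] := blow_up_branch d ua u0 hu ab.
have [h hh h0] := blow_up_branch d va v0 hv ab'.
exists g, h; split; [exact: hg | exact: hh |]; rewrite g0 h0.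
apply/orP; rewrite -negb_and; apply: contra j.
case: d {hg hh g0 h0} => [t|] /=.
  rewrite !mulr1 !addr_eq0 => /andP[/eqP -> /eqP ->].
  by apply/eqP; ring.
by rewrite !mulr0 !add0r !mulr1 => /andP[/eqP -> /eqP ->]; rewrite mulr0 mul0r subrr.
Qed.

Lemma exc_nontrivial d : ~ germ_sub (zeros (exc_eq d)) [set z : C2 R | z = 0].
Proof.
apply: linearized_nontrivial (linearized_exc d) (exc0 d) _.
by case: d => [t|]; rewrite xpair_eqE ?oner_eq0 ?andbF.
Qed.

(** Used to see that a total transform reduced to the exceptional curve is not a cross, so that a
    curvetta has to be chosen. *)
Lemma exc_cross_set_not_sub d (p : fgerm R * fgerm R) : cross p ->
  germ_sub (zeros (exc_eq d)) (cross_set p) ->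
  ~ germ_sub (cross_set p) (zeros (exc_eq d)).
Proof.
case: p => f g cp sub sup.
have key k l : cross (exc_eq d, k) -> cross (k, l) ->
    ~ germ_sub (zeros k) (zeros (exc_eq d)).
  move=> c c' ke; apply: (cross_nontrivial c').
  apply: near_C2S (near_C2I ke (cross_injective0 c)) => z [h1 h2] kz.
  exact: h2 (h1 kz) kz.
have [[_ c]|[_ c]] := exc_branch cp sub.
  apply: (key _ _ c (cross_sym cp)); apply: near_C2S sup => z h kz.
  by apply: h; right.
by apply: (key _ _ c cp); apply: near_C2S sup => z h kz; apply: h; left.
Qed.

(** A point of the exceptional curve is approached along a line crossing it, and [f] is Lipschitz.
    This is what permits cancelling powers of [exc_eq d]. *)
Lemma analytic_density d f : analytic f ->
  (\forall z \near (0 : C2 R), exc_eq d z != 0 -> f z = 0) ->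
  \forall z \near (0 : C2 R), f z = 0.
Proof.
have some t g : analytic g ->
    (\forall z \near (0 : C2 R), exc_eq (Some t) z != 0 -> g z = 0) ->
    \forall z \near (0 : C2 R), g z = 0.
  move=> /analytic_linearized[a [b /linearized_lipschitz[C C0 [r r0 Hr]]]].
  move=> /near_C2P[s s0 Hs]; apply/near_C2P; exists (Num.min r s).
    by rewrite lt_min r0.
  move=> [z1 z2] /=; rewrite !lt_min => /andP[r1 s1] /andP[r2 s2].
  have [z10|z10] := eqVneq z1 0; last exact: Hs.
  apply/eqP; rewrite -cnorm_eq0 eq_le cnorm_ge0 andbT.
  apply/ler_addgt0Pr => e e0; rewrite add0r.
  have eC : 0 < e / C by rewrite divr_gt0.
  have [x x0] : exists2 x : Cx R, x != 0 & cnorm x < Num.min (Num.min r s) (e / C).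
    by apply: near_small_real; rewrite !lt_min r0 s0.
  rewrite !lt_min ltr_pdivlMr // => /andP[/andP[xr xs] /ltW xe].
  have := Hr (z1, z2) (x, z2) r1 r2 xr r2; rewrite (Hs (x, z2) xs s2 x0) subr0.
  rewrite /= z10 sub0r cnormN subrr cnorm0 addr0 => h; apply: le_trans h _.
  by rewrite mulrC.
case: d => [t|]; first exact: some.
move=> fa /near_swap2 H; have := near_swap2 (some 0 _ (analytic_swap2 fa) H).
by apply: near_C2S => -[z1 z2].
Qed.

Lemma divides_zeros h f : divides h f -> germ_sub (zeros h) (zeros f).
Proof.
by move=> [q _ H]; apply: near_C2S H => z E hz; rewrite /zeros /= E hz mul0r.
Qed.

Lemma divides_exp h f k l : analytic h -> (k <= l)%N ->
  divides (fun z => h z ^+ l) f -> divides (fun z => h z ^+ k) f.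
Proof.
move=> ha kl [q qa H]; exists (fun z => h z ^+ (l - k) * q z).
  exact: analyticM (analyticX _ ha) qa.
by apply: near_C2S H => z ->; rewrite mulrA -exprD subnKC.
Qed.

Lemma vanishing_order_unique h f k l : analytic h ->
  vanishing_order h f k -> vanishing_order h f l -> k = l.
Proof.
move=> ha [dk ndk] [dl ndl]; case: (ltngtP k l) => // kl.
  by case: ndk; exact: divides_exp dl.
by case: ndl; exact: divides_exp dk.
Qed.

Lemma vanishing_order0 h f : analytic f -> ~ germ_sub (zeros h) (zeros f) ->
  vanishing_order h f 0.
Proof.
move=> fa nh; split.
  by exists f; [exact: fa | apply: near_C2W => z; rewrite expr0 mul1r].
move=> /divides_zeros H; apply: nh; apply: near_C2S H => z k hz; apply: k.
by rewrite /zeros /= expr1.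
Qed.

(** If h = h^2 q, then h (1 - h q) = 0 with a unit as second factor, so h vanishes near 0; the
    branch g = 0 would then be reduced to a point. *)
Lemma vanishing_order_self h g : cross (h, g) -> vanishing_order h h 1.
Proof.
move=> c; have [ha _ h0 _ _] := cross_elim c; split.
  exists (fun _ => 1); first exact: analytic_cst.
  by apply: near_C2W => z; rewrite expr1 mulr1.
move=> [q qa H].
pose k := fun z => 1 + (-1 * h z) * q z.
have ka : analytic k.
  exact: analyticD (analytic_cst 1) (analyticM (analyticM (analytic_cst (-1)) ha) qa).
have k0 : k 0 != 0 by rewrite /k h0 mulr0 mul0r addr0 oner_eq0.
apply: (cross_nontrivial (cross_sym c)).
apply: near_C2S (near_C2I H (near_C2I (analytic_neq0 ka k0) (cross_injective0 c))).
move=> z [E [kz inj]] gz; apply: inj => //.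
apply/eqP; have : h z * k z == 0.
  have -> : h z * k z = h z - h z ^+ 2 * q z by rewrite /k; ring.
  by rewrite -E subrr.
by rewrite mulf_eq0 (negPf kz) orbF.
Qed.

(** A further factor e would give G = e q outside the curve, hence everywhere by density, and G
    would vanish on the curve. *)
Lemma vanishing_order_exc d f G k : analytic G ->
  ~ germ_sub (zeros (exc_eq d)) (zeros G) ->
  (\forall z \near (0 : C2 R), f z = exc_eq d z ^+ k * G z) ->
  vanishing_order (exc_eq d) f k.
Proof.
move=> Ga nG fG; split; first by exists G; [exact: Ga | exact: fG].
move=> [q qa fq]; apply: nG.
pose H := fun z => G z + (-1 * exc_eq d z) * q z.
have Ha : analytic H.
  exact: analyticD Ga
    (analyticM (analyticM (analytic_cst (-1)) (analytic_exc d)) qa).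
have H0 : \forall z \near (0 : C2 R), exc_eq d z != 0 -> H z = 0.
  apply: near_C2S (near_C2I fG fq) => z [E1 E2] ez.
  apply: (mulfI (expf_neq0 k ez)); rewrite mulr0 /H mulrDr -E1 E2 exprSr.
  ring.
apply: near_C2S (analytic_density Ha H0) => z; rewrite /H => E ez.
by move: E; rewrite /zeros /= ez mulr0 mul0r addr0.
Qed.

Lemma strict_transform_exc d u g : strict_transform_of d u g ->
  \forall z \near (0 : C2 R), exc_eq d z = 0 -> g z = 0 -> z = 0.
Proof.
move=> [ga _ gc _]; have [g0|g0] := eqVneq (g 0) 0.
  exact: cross_injective0 (gc g0).
by apply: near_C2S (analytic_neq0 ga g0) => z /eqP.
Qed.

(* The quotient of [f] by a power of [exc_eq d] is a product of strict transforms
   and a unit, which does not vanish on the exceptional curve. *)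
Lemma order_exc d f w u v g h m k l : analytic w -> w 0 != 0 ->
  strict_transform_of d u g -> strict_transform_of d v h ->
  (\forall z \near (0 : C2 R), f z =
     w (chart d z) * u (chart d z) ^+ k * v (chart d z) ^+ l * exc_eq d z ^+ m) ->
  vanishing_order (exc_eq d) f (k + l + m).
Proof.
move=> wa w0 sg sh fE; have [ga ug _ _] := sg; have [ha vh _ _] := sh.
have wa' : analytic (fun z => w (chart d z)) by exact: analytic_chart.
apply: (@vanishing_order_exc _ _ (fun z => w (chart d z) * g z ^+ k * h z ^+ l)).
- exact: analyticM (analyticM wa' (analyticX k ga)) (analyticX l ha).
- move=> sub; apply: (@exc_nontrivial d).
  apply: near_C2S (near_C2I (near_C2I sub (near_chart d (analytic_neq0 wa w0)))
    (near_C2I (strict_transform_exc sg) (strict_transform_exc sh))).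
  move=> z [[h1 /negPf wz] [h2 h3]] ez; have := h1 ez.
  rewrite /zeros /= => /eqP; rewrite !mulf_eq0 !expf_eq0 wz /=.
  case/orP => /andP[_ /eqP]; [exact: h2 | exact: h3].
apply: near_C2S (near_C2I fE (near_C2I ug vh)) => z [-> [-> ->]].
by rewrite !exprD !exprMn; ring.
Qed.

End StrictTransforms.

(** * Total transforms and labels *)

Section Prefixes.
Variable T : eqType.
Implicit Types s t : seq T.

Lemma prefix_rcons_split s t x :
  prefix s (rcons t x) -> s = rcons t x \/ prefix s t.
Proof.
case/prefixP => s'; case/lastP: s' => [|s' y]; first by rewrite cats0; left.
by rewrite -rcons_cat => /rcons_inj[-> _]; right; exact: prefix_prefix.
Qed.

Lemma prefix_linear s s' t : prefix s t -> prefix s' t -> prefix s s' || prefix s' s.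
Proof.
rewrite !prefixE => /eqP E /eqP E'; case: (leqP (size s) (size s')) => ss.
  by rewrite -{1}E' take_takel // E eqxx.
have -> : take (size s') s = s' by rewrite -[X in take _ X]E take_takel ?(ltnW ss).
by rewrite eqxx orbT.
Qed.

End Prefixes.

Section Constellation.
Variables (R : realType) (K : constellation R).
Implicit Types (f g h : fgerm R) (z : C2 R) (d : option (Cx R)).
Implicit Types (P Q : inf_near R) (v : label R) (A : set (C2 R)).

Lemma proj_exc0 Q P d z : prefix Q P -> exc_eq d z = 0 ->
  proj Q (rcons P d) z = 0.
Proof. by move=> QP /chart_eq0 c; rewrite proj_rcons // c proj0. Qed.

Lemma cross_set0 P : P \in points K -> cross_set (branches K P) 0.
Proof. by move=> /branchesP[_ [h _] _]; left. Qed.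

Lemma points_rcons P d : rcons P d \in points K -> P \in points K.
Proof. by move=> h; apply: points_closed h _; rewrite prefix_rcons. Qed.

(** A point has finitely many prefixes, so the neighbourhoods can be intersected. *)
Lemma near_prefix (A : inf_near R -> C2 R -> Prop) P :
  (forall Q, prefix Q P -> \forall z \near (0 : C2 R), A Q z) ->
  \forall z \near (0 : C2 R), forall Q, prefix Q P -> A Q z.
Proof.
elim/last_ind: P => [|P d IH] H.
  apply: near_C2S (H [::] isT) => z h Q; rewrite prefixs0 => /eqP ->; exact: h.
have H1 := H (rcons P d) (prefix_refl _).
have H2 : \forall z \near (0 : C2 R), forall Q, prefix Q P -> A Q z.
  apply: IH => Q QP; apply: H; exact: prefix_trans QP (prefix_rcons _ _).
apply: near_C2S (near_C2I H1 H2) => z [h1 h2] Q.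
by case/prefix_rcons_split => [->|/h2].
Qed.

(** By compatibility, the pullback to P of every cross at a lower point is already contained in that
    of P. *)
Lemma total_transform_rcons P d : rcons P d \in points K ->
  germ_eq (total_transform K (rcons P d)) (chart d @^-1` cross_set (branches K P)).
Proof.
move=> hQ; have hP := points_rcons hQ; split; last first.
  apply: near_C2W => z h; exists P; split.
  - exact: prefix_rcons.
  - by apply/eqP => /(congr1 size); rewrite size_rcons => /n_Sn.
  - by rewrite proj_last.
have H : \forall z \near (0 : C2 R), forall Q, prefix Q P ->
    cross_set (branches K Q) (proj Q P z) -> cross_set (branches K P) z.
  apply: near_prefix => Q QP.
  exact: branches_compat (points_closed hP QP) hP QP.
apply: near_C2S (near_chart d H) => z h [Q [QP /eqP QneP c]].
case: (prefix_rcons_split QP) => // QP'; apply: (h _ QP').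
by rewrite -(proj_rcons _ _ QP').
Qed.

Lemma chart_cross_sub P d : rcons P d \in points K ->
  germ_sub (chart d @^-1` cross_set (branches K P))
           (cross_set (branches K (rcons P d))).
Proof.
move=> hQ; have hP := points_rcons hQ.
apply: near_C2S (branches_compat hP hQ (prefix_rcons _ _)) => z h c.
by apply: h; rewrite /preimage /= proj_last.
Qed.

Lemma exc_sub_cross P d : rcons P d \in points K ->
  germ_sub (zeros (exc_eq d)) (cross_set (branches K (rcons P d))).
Proof.
move=> hQ; apply: germ_sub_trans (chart_cross_sub hQ); apply: near_C2W => z.
by move=> /chart_eq0; rewrite /preimage /= => ->; exact: cross_set0 (points_rcons hQ).
Qed.

Lemma contracted_sub_total Q z : Q != [::] -> proj [::] Q z = 0 ->
  total_transform K Q z.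
Proof.
move=> Q0 h; exists [::]; split; [exact: prefix0s | by rewrite eq_sym |].
by rewrite h; exact: cross_set0 (origin_in K).
Qed.

(** Arbitrary equations [u1], [u2] of X_P are allowed, as the lemma serves both for [branches] and
    for the equations of a frame. *)
Lemma total_transform_strict P d u1 u2 g1 g2 : rcons P d \in points K ->
  strict_transform_of d u1 g1 -> strict_transform_of d u2 g2 ->
  germ_eq (zeros u1 `|` zeros u2) (cross_set (branches K P)) ->
  germ_eq (total_transform K (rcons P d))
          (zeros (exc_eq d) `|` (zeros g1 `|` zeros g2)).
Proof.
move=> hQ [_ ug1 _ _] [_ ug2 _ _] [h1 h2]; have [t1 t2] := total_transform_rcons hQ.
split.
  apply: germ_sub_trans t1 _.
  apply: near_C2S (near_C2I (near_chart d h2) (near_C2I ug1 ug2)) => z [k [e1 e2]] c.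
  case: (k c); rewrite /zeros /= ?e1 ?e2 => /eqP; rewrite mulf_eq0.
    by case/orP => /eqP ?; [left | right; left].
  by case/orP => /eqP ?; [left | right; right].
apply: germ_sub_trans _ t2.
apply: near_C2S (near_C2I (near_chart d h1) (near_C2I ug1 ug2)) => z [k [e1 e2]] c.
apply: k; rewrite /zeros /= e1 e2; case: c => [e0|[g0|g0]].
- by left; rewrite [X in X * _]e0 mul0r.
- by left; rewrite [X in _ * X]g0 mulr0.
- by right; rewrite [X in _ * X]g0 mulr0.
Qed.

(** If one of the strict transforms of X_P passed through Q, the other would not, and the total
    transform would be the cross formed by it and the exceptional curve. *)
Lemma curvetta_total Q : needs_curvetta K Q -> exists P d,
  Q = rcons P d /\ germ_sub (total_transform K Q) (zeros (exc_eq d)).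
Proof.
case/lastP: Q => [|P d] [hQ Q0 nc] //; exists P, d; split=> //.
have hP := points_rcons hQ; have := branchesP hP.
rewrite [branches K P]surjective_pairing => /(blow_up_cross d)[g1 [g2 [s1 s2 ne]]].
have [t1 t2] := total_transform_strict hQ s1 s2 (germ_eq_refl _).
have [g1a _ c1 _] := s1; have [g2a _ c2 _] := s2.
have ne1 : g1 0 != 0.
  apply/eqP => g10; case: ne => [|g20]; first by rewrite g10 eqxx.
  apply: nc; exists (exc_eq d, g1); split; first exact: c1.
    apply: near_C2S (near_C2I t1 (analytic_neq0 g2a g20)) => z [k /eqP nz] /k.
    by case=> [|[|//]]; [left | right].
  by apply: near_C2S t2 => z k [c|c]; apply: k; [left | right; left].
have ne2 : g2 0 != 0.
  apply/eqP => g20; apply: nc; exists (exc_eq d, g2); split; first exact: c2.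
    apply: near_C2S (near_C2I t1 (analytic_neq0 g1a ne1)) => z [k /eqP nz] /k.
    by case=> [|[//|]]; [left | right].
  by apply: near_C2S t2 => z k [c|c]; apply: k; [left | right; right].
apply: near_C2S (near_C2I t1 (near_C2I (analytic_neq0 g1a ne1) (analytic_neq0 g2a ne2))).
by move=> z [k [/eqP n1 /eqP n2]] /k[|[|]].
Qed.

Lemma curve_germ_inv v Q h : curve_germ K v Q h ->
  match v with
  | Initial => Q = [::] /\ h = (branches K [::]).1
  | Second => Q = [::] /\ h = (branches K [::]).2
  | Curvetta P => [/\ Q = P, needs_curvetta K Q,
      h = (branches K Q).1 \/ h = (branches K Q).2
    & ~ germ_sub (zeros h) [set z | proj [::] Q z = 0]]
  | Lateral P => exists2 d, Q = rcons P d & h = exc_eq d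
  end.
Proof. by case=> // P d; exists d. Qed.

Lemma curve_germ_base v Q h : curve_germ K v Q h ->
  (exists P, v = Lateral P) \/ germ_sub (zeros h) (cross_set (branches K Q)).
Proof.
move=> c; have := curve_germ_inv c; case: v {c} => [||P|P].
- by move=> [-> ->]; right; apply: near_C2W => z; left.
- by move=> [-> ->]; right; apply: near_C2W => z; right.
- by move=> [_ _ [->|->] _]; right; apply: near_C2W => z; [left | right].
- by left; exists P.
Qed.

Lemma curve_germ_analytic v Q h : curve_germ K v Q h -> analytic h.
Proof.
move=> c; have := curve_germ_inv c; have [[a1 a2] _ _] := branchesP (origin_in K).
case: v {c} => [||P|P].
- by move=> [_ ->]; exact: a1.
- by move=> [_ ->]; exact: a2.
- by move=> [_ [/branchesP[[b1 b2] _ _] _ _] [->|->] _]; [exact: b1 | exact: b2].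
- by move=> [d _ ->]; exact: analytic_exc.
Qed.

(** One branch of X_Q is the exceptional curve, which is contracted to O; so a branch that is not
    contracted is the other one. *)
Lemma curvetta_cross Q P d h : needs_curvetta K Q -> Q = rcons P d ->
  h = (branches K Q).1 \/ h = (branches K Q).2 ->
  ~ germ_sub (zeros h) [set z | proj [::] Q z = 0] -> cross (exc_eq d, h).
Proof.
move=> [hQ _ _] EQ hh nc; rewrite EQ in hQ hh nc.
have ec k : germ_eq (zeros k) (zeros (exc_eq d)) ->
    germ_sub (zeros k) [set z | proj [::] (rcons P d) z = 0].
  move=> [ke _]; apply: near_C2S ke => z h' /h' e; exact: proj_exc0 (prefix0s _) e.
have [[E c]|[E c]] := exc_branch (branchesP hQ) (exc_sub_cross hQ).
  by case: hh => Eh; [case: nc; rewrite Eh; exact: ec | rewrite Eh; exact: c].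
by case: hh => Eh; [rewrite Eh; exact: c | case: nc; rewrite Eh; exact: ec].
Qed.

(** The curve E_P' is contracted by the projection to any point Q below or equal to P', which
    excludes for its branches the labels of curves first seen at Q. *)
Lemma label_contracted_exc P P' Q d h : prefix Q P' -> prefix (rcons P' d) P ->
  germ_sub (zeros h) (proj (rcons P' d) P @^-1` zeros (exc_eq d)) ->
  germ_sub (zeros h) [set z | proj Q P z = 0].
Proof.
move=> QP' P'P; apply: near_C2S => z k hz; rewrite /=.
rewrite (proj_comp _ (prefix_trans QP' (prefix_rcons _ _)) P'P).
exact: proj_exc0 QP' (k hz).
Qed.

(** At Q' the pullback of X_Q is part of the total transform, which is reduced to an exceptional
    curve contracted to Q. *)
Lemma label_contracted_total P Q Q' h : needs_curvetta K Q' ->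
  prefix Q Q' -> Q != Q' -> prefix Q' P ->
  germ_sub (zeros h) (proj Q P @^-1` cross_set (branches K Q)) ->
  germ_sub (zeros h) [set z | proj Q P z = 0].
Proof.
move=> nc QQ' neQ Q'P hX; have [P' [d [EQ' te]]] := curvetta_total nc.
apply: near_C2S (near_C2I hX (near_proj Q' P te)) => z [k1 k2] hz /=.
rewrite (proj_comp _ QQ' Q'P).
have ez : zeros (exc_eq d) (proj Q' P z).
  by apply: k2; exists Q; split=> //; rewrite -proj_comp //; exact: k1.
rewrite EQ'; apply: proj_exc0 => //; last by rewrite -EQ'.
by move: QQ' neQ; rewrite EQ' => /prefix_rcons_split[->|//]; rewrite eqxx.
Qed.

(* A curvetta meets the exceptional divisor only at its base point. *)
Lemma label_curvetta_exc P P' Q d g h : curve_germ K (Curvetta Q) Q g ->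
  prefix (rcons P' d) Q -> prefix Q P ->
  germ_sub (zeros h) (proj Q P @^-1` zeros g) ->
  germ_sub (zeros h) (proj (rcons P' d) P @^-1` zeros (exc_eq d)) ->
  germ_sub (zeros h) [set z | proj Q P z = 0].
Proof.
move=> /curve_germ_inv[_ nc hg ncg] P'Q QP hQ hP'.
have [P1 [e [EQ te]]] := curvetta_total nc.
have Q0 : Q != [::] by case: nc.
have inj := cross_injective0 (curvetta_cross nc EQ hg ncg).
apply: near_C2S (near_C2I (near_C2I hQ hP') (near_C2I (near_proj Q P te) (near_proj Q P inj))).
move=> z [[k1 k2] [k3 k4]] hz /=; apply: k4; last exact: k1.
apply: k3; apply: contracted_sub_total Q0 _.
rewrite -(proj_comp _ (prefix0s Q) QP).
rewrite (proj_comp _ (prefix0s (rcons P' d)) (prefix_trans P'Q QP)).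
exact: proj_exc0 (prefix0s _) (k2 hz).
Qed.

(** The points Q and Q' where the two curves first appear are prefixes of P, hence comparable. When
    they differ, the branch is contracted at one of them; when they coincide, distinct curves of the
    list meet only at that point. *)
Lemma has_label_unique P h v v' :
  has_label K P h v -> has_label K P h v' -> v = v'.
Proof.
have half u u' Q Q' g g' : prefix Q Q' -> prefix Q' P ->
    curve_germ K u Q g -> curve_germ K u' Q' g' ->
    germ_sub (zeros h) (proj Q P @^-1` zeros g) ->
    germ_sub (zeros h) (proj Q' P @^-1` zeros g') ->
    ~ germ_sub (zeros h) [set z | proj Q P z = 0] ->
    ~ germ_sub (zeros h) [set z | proj Q' P z = 0] -> u = u'.
  move=> QQ' Q'P c c' hQ hQ' n n'; have QP := prefix_trans QQ' Q'P.
  have i := curve_germ_inv c; have i' := curve_germ_inv c'.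
  have LX : (forall P1, u <> Lateral P1) ->
      germ_sub (zeros h) (proj Q P @^-1` cross_set (branches K Q)).
    move=> nl; case: (curve_germ_base c) => [[P1 /nl //]|gX].
    by apply: near_C2S (near_C2I hQ (near_proj Q P gX)) => z [k1 k2] /k1/k2.
  (* For an exceptional curve older than the curvetta, the contradiction comes from contraction at
     the higher point Q'. *)
  have LC Q1 : u' = Curvetta Q1 -> (exists P1, u = Lateral P1) -> u = u'.
    move=> E [P1 E1]; rewrite {}E in i' c'; rewrite {}E1 in i.
    case: i => d EQ Eg; have [EQ1 _ _ _] := i'.
    rewrite -{}EQ1 in c'; rewrite {}EQ {}Eg in hQ QQ'.
    by case: n'; exact: label_curvetta_exc c' QQ' Q'P hQ' hQ.
  have ZZ : Q' = [::] -> Q = [::].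
    by move=> E; move: QQ'; rewrite E prefixs0 => /eqP.
  have IJ : Q = [::] -> Q' = [::] -> 
      germ_sub (zeros h) (proj [::] P @^-1` zeros (branches K [::]).1) ->
      germ_sub (zeros h) (proj [::] P @^-1` zeros (branches K [::]).2) -> False.
    move=> EQ _ h1 h2; apply: n; rewrite EQ.
    have := branchesP (origin_in K); rewrite [branches K [::]]surjective_pairing.
    move=> /cross_injective0/(near_proj [::] P) inj.
    apply: near_C2S (near_C2I (near_C2I h1 h2) inj) => z [[k1 k2] k3] hz /=.
    by apply: k3; [exact: k1 | exact: k2].
  case: u' c' i' LC => [||Q1|P2] c' i' LC.
  - case: i' => E' Eg'; have E := ZZ E'; rewrite E' Eg' in hQ'.
    case: u c i LX LC => [||Q1|P1] c i LX LC.
    + by [].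
    + by case: i => _ Eg; rewrite E Eg in hQ; case: (IJ E E' hQ' hQ).
    + by case: i => _ [_]; rewrite E.
    + by case: i => d; rewrite E => /(congr1 size); rewrite size_rcons.
  - case: i' => E' Eg'; have E := ZZ E'; rewrite E' Eg' in hQ'.
    case: u c i LX LC => [||Q1|P1] c i LX LC.
    + by case: i => _ Eg; rewrite E Eg in hQ; case: (IJ E E' hQ hQ').
    + by [].
    + by case: i => _ [_]; rewrite E.
    + by case: i => d; rewrite E => /(congr1 size); rewrite size_rcons.
  - have [EQ1 nc hg ncg] := i'.
    have total : (forall P1, u <> Lateral P1) -> Q != Q' -> u = Curvetta Q1.
      move=> nl neQ; case: n.
      exact: label_contracted_total nc QQ' neQ Q'P (LX nl).
    case: u c i {LX} LC total => [||Q2|P1] c i LC total.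
    + by apply: total => //; case: i => -> _; rewrite eq_sym; case: nc.
    + by apply: total => //; case: i => -> _; rewrite eq_sym; case: nc.
    + have [EQ2 _ _ _] := i; have [E|neQ] := eqVneq Q Q'; last exact: total.
      by rewrite -EQ2 -EQ1 E.
    + by apply: (LC Q1) => //; exists P1.
  - case: i' => d' EQ' Eg'; rewrite EQ' Eg' in hQ'.
    have [EQ|neQ] := eqVneq Q Q'; last first.
      case: n; rewrite EQ' in Q'P QQ' neQ; apply: label_contracted_exc Q'P hQ'.
      by case/prefix_rcons_split: QQ' neQ => [->|//]; rewrite eqxx.
    rewrite EQ' in EQ; case: u c i LX LC => [||Q1|P1] c i LX LC.
    + by case: i; rewrite EQ => /(congr1 size); rewrite size_rcons.
    + by case: i; rewrite EQ => /(congr1 size); rewrite size_rcons.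
    + have [EQ1 _ _ _] := i; rewrite -EQ1 in c.
      case: n; apply: (label_curvetta_exc c _ QP hQ hQ').
      by rewrite EQ prefix_refl.
    + by case: i => d; rewrite EQ => /rcons_inj[-> _].
move=> [Q [g [c QP hQ n]]] [Q' [g' [c' Q'P hQ' n']]].
case/orP: (prefix_linear QP Q'P) => QQ'.
  exact: half QQ' Q'P c c' hQ hQ' n n'.
exact/esym/(half _ _ _ _ _ _ QQ' QP c' c hQ' hQ n' n).
Qed.

Lemma has_label_germ_eq P h h' v : germ_eq (zeros h) (zeros h') ->
  has_label K P h v -> has_label K P h' v.
Proof.
move=> [hh' h'h] [Q [g [c QP hQ n]]]; exists Q, g; split=> //.
  exact: germ_sub_trans h'h hQ.
by move=> n'; apply: n; exact: germ_sub_trans hh' n'.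
Qed.

(** The covering clause of [strict_transform_of] is needed here: were the strict transform
    contracted to Q, so would be the branch u = 0 that it covers. *)
Lemma has_label_strict P d u g v : strict_transform_of d u g -> g 0 = 0 ->
  has_label K P u v -> has_label K (rcons P d) g v.
Proof.
move=> [_ ug _ lift] g0 [Q [k [c QP hQ n]]]; exists Q, k; split=> //.
- exact: prefix_trans QP (prefix_rcons _ _).
- apply: near_C2S (near_C2I ug (near_chart d hQ)) => z [E h] gz.
  rewrite /preimage /= proj_rcons //; apply: h.
  by rewrite /zeros /= E [X in _ * X]gz mulr0.
- move=> H; apply: n; apply: (lift g0 [set z | proj Q P z = 0]); first exact: proj0.
  by apply: near_C2S H => z k' /k' /=; rewrite proj_rcons.
Qed.

Lemma has_label_exc P d : has_label K (rcons P d) (exc_eq d) (Lateral P).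
Proof.
exists (rcons P d), (exc_eq d); split.
- exact: curve_lateral.
- exact: prefix_refl.
- by apply: near_C2W => z; rewrite /preimage /= proj_id.
- move=> H; apply: (@exc_nontrivial _ d); apply: near_C2S H => z k /k /=.
  by rewrite proj_id.
Qed.

End Constellation.

(** * The monomial form of the 2-form and of the initial branch *)

Section Invariants.
Variables (R : realType) (K : constellation R) (w : fgerm R).
Hypotheses (w_analytic : analytic w) (w_neq0 : w 0 != 0).
Implicit Types (f g h : fgerm R) (z : C2 R) (d : option (Cx R)).
Implicit Types (P Q : inf_near R) (v : label R) (p : nat * nat).

Definition form_at Q : fgerm R := fun z => w (proj [::] Q z) * jac (proj [::] Q) z.
Definition initial_at Q : fgerm R := fun z => (branches K [::]).1 (proj [::] Q z).

Lemma origin_cross : cross ((branches K [::]).1, (branches K [::]).2).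
Proof. by rewrite -surjective_pairing; exact: branchesP (origin_in K). Qed.

Lemma form_at_analytic Q : analytic (form_at Q).
Proof.
rewrite /form_at proj_nil.
exact: (analyticM (analytic_blowdown Q w_analytic) (analytic_jac_blowdown Q)).
Qed.

Lemma initial_at_analytic Q : analytic (initial_at Q).
Proof.
have [La _ _ _ _] := cross_elim origin_cross.
by rewrite /initial_at proj_nil; exact: (analytic_blowdown Q La).
Qed.

Lemma form_at_zeros Q :
  germ_sub (zeros (form_at Q)) [set z | proj [::] Q z = 0].
Proof.
apply: near_C2S (near_proj [::] Q (analytic_neq0 w_analytic w_neq0)) => z /negPf nz.
rewrite /zeros /form_at /= => /eqP; rewrite mulf_eq0 nz /= proj_nil => /eqP.
exact: jac_blowdown_eq0.
Qed.

Lemma form_at_nil z : form_at [::] z = w z.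
Proof. by rewrite /form_at proj_nil jac_nil mulr1. Qed.

Lemma form_at_rcons P d z :
  form_at (rcons P d) z = form_at P (chart d z) * exc_eq d z.
Proof. by rewrite /form_at !proj_nil jac_rcons blowdown_rcons mulrA. Qed.

Lemma initial_at_rcons P d z : initial_at (rcons P d) z = initial_at P (chart d z).
Proof. by rewrite /initial_at !proj_nil blowdown_rcons. Qed.

Lemma germ_pairP Q h k l : vanishing_order h (form_at Q) k ->
  vanishing_order h (initial_at Q) l -> germ_pair K w Q h (k.+1, l).
Proof. by move=> hk hl; split; [exists k | exact: hl]. Qed.

Lemma curve_pair_initial : curve_pair K w Initial (1, 1)%N.
Proof.
move=> Q h /curve_germ_inv[-> ->]; apply: germ_pairP.
  apply: vanishing_order0; first exact: form_at_analytic.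
  move=> sub; apply: (cross_nontrivial origin_cross).
  apply: near_C2S (near_C2I sub (analytic_neq0 w_analytic w_neq0)).
  by move=> z [k /eqP nz] hz; case: nz; rewrite -form_at_nil; exact: k hz.
exact: vanishing_order_self origin_cross.
Qed.

Lemma curve_pair_second : curve_pair K w Second (1, 0)%N.
Proof.
move=> Q h /curve_germ_inv[-> ->]; have nt := cross_nontrivial (cross_sym origin_cross).
apply: germ_pairP; apply: vanishing_order0.
- exact: form_at_analytic.
- move=> sub; apply: nt.
  apply: near_C2S (near_C2I sub (analytic_neq0 w_analytic w_neq0)).
  by move=> z [k /eqP nz] hz; case: nz; rewrite -form_at_nil; exact: k hz.
- exact: initial_at_analytic.
- move=> sub; apply: nt.
  apply: near_C2S (near_C2I sub (cross_injective0 origin_cross)) => z [k1 k2] hz.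
  by apply: k2; [exact: k1 hz | exact: hz].
Qed.

(** Where a curvetta is needed the total transform is the exceptional curve, so neither L nor the
    2-form can vanish along a branch that is not contracted. *)
Lemma curve_pair_curvetta Q : curve_pair K w (Curvetta Q) (1, 0)%N.
Proof.
move=> Q' h /curve_germ_inv[EQ nc _ nch]; apply: germ_pairP; apply: vanishing_order0.
- exact: form_at_analytic.
- by move=> sub; apply: nch; exact: germ_sub_trans sub (form_at_zeros Q').
- exact: initial_at_analytic.
move=> sub; apply: nch; have [P [d [EQ' te]]] := curvetta_total nc.
have Q0 : [::] != Q' by rewrite eq_sym; case: nc.
apply: near_C2S (near_C2I sub te) => z [k1 k2] hz /=; rewrite EQ'.
apply: proj_exc0 (prefix0s P) _; apply: k2; exists [::]; split.
- exact: prefix0s.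
- exact: Q0.
- by left; exact: k1.
Qed.

Lemma curve_pair_base v : base_vertex K v -> v <> Initial ->
  curve_pair K w v (1, 0)%N.
Proof.
case: v => // [_ _|Q _ _]; [exact: curve_pair_second | exact: curve_pair_curvetta].
Qed.

Lemma curve_pair_unique v Q h p q : curve_germ K v Q h ->
  curve_pair K w v p -> curve_pair K w v q -> p = q.
Proof.
move=> c /(_ _ _ c)[[k Ek pk] pl] /(_ _ _ c)[[m Em qm] ql].
have ha := curve_germ_analytic c.
have E1 := vanishing_order_unique ha pk qm; have E2 := vanishing_order_unique ha pl ql.
by rewrite [p]surjective_pairing [q]surjective_pairing Ek Em E1 E2.
Qed.

(* The exponents are (lambda - 1, ord L) for the curves that label the branches
   of [u]. *)
Definition frame P (u : fgerm R * fgerm R) v1 v2 p1 p2 : Prop :=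
  [/\ cross u, has_label K P u.1 v1, has_label K P u.2 v2,
      curve_pair K w v1 (p1.1.+1, p1.2) /\ curve_pair K w v2 (p2.1.+1, p2.2) &
      exists A B : fgerm R, [/\ analytic A /\ A 0 != 0, analytic B /\ B 0 != 0,
        \forall z \near (0 : C2 R), form_at P z = A z * u.1 z ^+ p1.1 * u.2 z ^+ p2.1 &
        \forall z \near (0 : C2 R),
          initial_at P z = B z * u.1 z ^+ p1.2 * u.2 z ^+ p2.2]].

Lemma frame_sym P u1 u2 v1 v2 p1 p2 :
  frame P (u1, u2) v1 v2 p1 p2 -> frame P (u2, u1) v2 v1 p2 p1.
Proof.
move=> [c l1 l2 [q1 q2] [A [B [hA hB fA fB]]]]; split.
- exact: cross_sym.
- exact: l2.
- exact: l1.
- by split.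
exists A, B; split; [exact: hA | exact: hB | |].
  by apply: near_C2S fA => z ->; rewrite mulrAC.
by apply: near_C2S fB => z ->; rewrite mulrAC.
Qed.

Lemma frame_lateral P u v1 v2 p1 p2 : frame P u v1 v2 p1 p2 ->
  curve_pair K w (Lateral P) ((p1.1 + p2.1 + 1).+1, p1.2 + p2.2)%N.
Proof.
move=> [c _ _ _ [A [B [[Aa A0] [Ba B0] fA fB]]]] Q h /curve_germ_inv[d -> ->].
rewrite (surjective_pairing u) in c.
have [g1 [g2 [s1 s2 _]]] := blow_up_cross d c.
apply: germ_pairP.
  apply: (order_exc Aa A0 s1 s2).
  by apply: near_C2S (near_chart d fA) => z E; rewrite form_at_rcons E expr1.
rewrite -[(p1.2 + p2.2)%N]addn0; apply: (order_exc Ba B0 s1 s2).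
by apply: near_C2S (near_chart d fB) => z E; rewrite initial_at_rcons E expr0 mulr1.
Qed.

(** The other strict transform does not vanish at the new point, so its powers join the unit
    factors. *)
Lemma frame_blow_up P d u1 u2 v1 v2 p1 p2 g1 g2 : frame P (u1, u2) v1 v2 p1 p2 ->
  strict_transform_of d u1 g1 -> strict_transform_of d u2 g2 ->
  g1 0 = 0 -> g2 0 != 0 ->
  frame (rcons P d) (exc_eq d, g1) (Lateral P) v1
        (p1.1 + p2.1 + 1, p1.2 + p2.2)%N p1.
Proof.
move=> hf s1 s2 g10 g20; have hl := frame_lateral hf.
have [_ l1 _ [q1 _] [A [B [[Aa A0] [Ba B0] fA fB]]]] := hf.
have [g1a ug1 c1 _] := s1; have [g2a ug2 _ _] := s2.
split.
- exact: c1.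
- exact: has_label_exc.
- exact: has_label_strict s1 g10 l1.
- by split; [exact: hl | exact: q1].
exists (fun z => A (chart d z) * g2 z ^+ p2.1), (fun z => B (chart d z) * g2 z ^+ p2.2).
split.
- split; last by rewrite chart0 mulf_neq0 // expf_neq0.
  exact: analyticM (analytic_chart d Aa) (analyticX _ g2a).
- split; last by rewrite chart0 mulf_neq0 // expf_neq0.
  exact: analyticM (analytic_chart d Ba) (analyticX _ g2a).
- apply: near_C2S (near_C2I (near_chart d fA) (near_C2I ug1 ug2)) => z [E [/= e1 e2]].
  by rewrite form_at_rcons E /= e1 e2 !exprMn !exprD expr1; ring.
- apply: near_C2S (near_C2I (near_chart d fB) (near_C2I ug1 ug2)) => z [E [/= e1 e2]].
  by rewrite initial_at_rcons E /= e1 e2 !exprMn !exprD; ring.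
Qed.

Lemma frame_curvetta P d u1 u2 v1 v2 p1 p2 g1 g2 h v : frame P (u1, u2) v1 v2 p1 p2 ->
  strict_transform_of d u1 g1 -> strict_transform_of d u2 g2 ->
  g1 0 != 0 -> g2 0 != 0 ->
  cross (exc_eq d, h) -> has_label K (rcons P d) h v -> curve_pair K w v (1, 0)%N ->
  frame (rcons P d) (exc_eq d, h) (Lateral P) v
        (p1.1 + p2.1 + 1, p1.2 + p2.2)%N (0, 0)%N.
Proof.
move=> hf s1 s2 g10 g20 ch lh qh; have hl := frame_lateral hf.
have [_ _ _ _ [A [B [[Aa A0] [Ba B0] fA fB]]]] := hf.
have [g1a ug1 _ _] := s1; have [g2a ug2 _ _] := s2.
split.
- exact: ch.
- exact: has_label_exc.
- exact: lh.
- by split; [exact: hl | exact: qh].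
exists (fun z => A (chart d z) * g1 z ^+ p1.1 * g2 z ^+ p2.1),
       (fun z => B (chart d z) * g1 z ^+ p1.2 * g2 z ^+ p2.2).
split.
- split; last by rewrite chart0 !mulf_neq0 // expf_neq0.
  exact: analyticM (analyticM (analytic_chart d Aa) (analyticX _ g1a)) (analyticX _ g2a).
- split; last by rewrite chart0 !mulf_neq0 // expf_neq0.
  exact: analyticM (analyticM (analytic_chart d Ba) (analyticX _ g1a)) (analyticX _ g2a).
- apply: near_C2S (near_C2I (near_chart d fA) (near_C2I ug1 ug2)) => z [E [/= e1 e2]].
  by rewrite form_at_rcons E /= e1 e2 !exprMn !exprD expr1 expr0; ring.
- apply: near_C2S (near_C2I (near_chart d fB) (near_C2I ug1 ug2)) => z [E [/= e1 e2]].
  by rewrite initial_at_rcons E /= e1 e2 !exprMn !exprD expr0; ring.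
Qed.

(** The equations of a frame need not be those of the cross: agreement of zero sets suffices, since
    labels depend only on them. *)
Definition framed P (x : fgerm R * fgerm R) : Prop :=
  exists u v1 v2 p1 p2, [/\ frame P u v1 v2 p1 p2,
    germ_eq (zeros u.1) (zeros x.1) & germ_eq (zeros u.2) (zeros x.2)].

Lemma framed_sym P x1 x2 : framed P (x1, x2) -> framed P (x2, x1).
Proof.
move=> [[u1 u2] [v1 [v2 [p1 [p2 [hf h1 h2]]]]]].
by exists (u2, u1), v2, v1, p2, p1; split; [exact: frame_sym | exact: h2 | exact: h1].
Qed.

Lemma framed_origin : framed [::] (branches K [::]).
Proof.
have nt := cross_nontrivial origin_cross.
have nt' := cross_nontrivial (cross_sym origin_cross).
exists ((branches K [::]).1, (branches K [::]).2), Initial, Second, (0, 1)%N, (0, 0)%N.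
split; [|exact: germ_eq_refl | exact: germ_eq_refl].
have lab h v : curve_germ K v [::] h -> ~ germ_sub (zeros h) [set z | z = 0] ->
    has_label K [::] h v.
  move=> c n; exists [::], h; split.
  - exact: c.
  - exact: prefix_refl.
  - by apply: near_C2W => z; rewrite /preimage /= proj_id.
  - by move=> H; apply: n; apply: near_C2S H => z k /k; rewrite /= proj_id.
split.
- exact: origin_cross.
- by apply: lab nt; exact: curve_initial.
- by apply: lab nt'; exact: curve_second.
- by split; [exact: curve_pair_initial | exact: curve_pair_second].
exists w, (fun _ => 1); split.
- by split; [exact: w_analytic | exact: w_neq0].
- by split; [exact: analytic_cst | exact: oner_neq0].
- by apply: near_C2W => z; rewrite [form_at _ _]form_at_nil !expr0 !mulr1.
- by apply: near_C2W => z; rewrite /initial_at proj_nil expr0 expr1 mulr1 mul1r.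
Qed.

(** A strict transform through the new point lies in X_Q by compatibility of the crosses, so it must
    be its second branch; if none passes, that branch is a curvetta. The disjunction on [branches]
    lets the exceptional curve come first or second. *)
Lemma framed_step P d x1 x2 : rcons P d \in points K ->
  branches K (rcons P d) = (x1, x2) \/ branches K (rcons P d) = (x2, x1) ->
  germ_eq (zeros x1) (zeros (exc_eq d)) -> cross (exc_eq d, x2) ->
  framed P (branches K P) -> framed (rcons P d) (x1, x2).
Proof.
move=> hQ hx x1e cx [[u1 u2] [v1 [v2 [p1 [p2 [hf h1 h2]]]]]].
have [cu _ _ _ _] := hf; have [g1 [g2 [s1 s2 ne]]] := blow_up_cross d cu.
have hu : germ_eq (zeros u1 `|` zeros u2) (cross_set (branches K P)).
  case: h1 h2 => [a1 b1] [a2 b2].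
  by split; [exact: germ_sub_or a1 a2 | exact: germ_sub_or b1 b2].
have [t1 t2] := total_transform_strict hQ s1 s2 hu.
have tx : germ_sub (zeros (exc_eq d) `|` (zeros g1 `|` zeros g2))
                   (zeros (exc_eq d) `|` zeros x2).
  have [_ c2] := total_transform_rcons hQ; have [c1 _] := total_transform_rcons hQ.
  apply: germ_sub_trans t2 _; apply: germ_sub_trans c1 _.
  apply: germ_sub_trans (chart_cross_sub hQ) _.
  have [xe _] := x1e; apply: near_C2S xe => z k.
  by case: hx => -> [/=|/=]; [move/k; left | right | right | move/k; left].
(* The first use of [same_branch] turns an inclusion outside the exceptional curve into the reverse
   inclusion, and the second use turns it back, now without exception. *)
have g12 k : cross (exc_eq d, k) -> germ_sub (zeros k) (zeros (exc_eq d) `|` zeros x2) ->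
    germ_eq (zeros k) (zeros x2).
  move=> ck kx; have xk := same_branch ck cx kx; split=> //.
  by apply: (same_branch cx ck); apply: near_C2S xk => z h /h; right.
have [g10|g10] := eqVneq (g1 0) 0.
  have g20 : g2 0 != 0 by case: ne => //; rewrite g10 eqxx.
  do 5 eexists; split; first exact: frame_blow_up hf s1 s2 g10 g20.
    exact: germ_eq_sym.
  have [_ _ c1 _] := s1; apply: (g12 _ (c1 g10)).
  by apply: near_C2S tx => z k gz; apply: k; right; left.
have [g20|g20] := eqVneq (g2 0) 0.
  do 5 eexists; split; first exact: frame_blow_up (frame_sym hf) s2 s1 g20 g10.
    exact: germ_eq_sym.
  have [_ _ c2 _] := s2; apply: (g12 _ (c2 g20)).
  by apply: near_C2S tx => z k gz; apply: k; right; right.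
have [g1a _ _ _] := s1; have [g2a _ _ _] := s2.
have te : germ_sub (total_transform K (rcons P d)) (zeros (exc_eq d)).
  apply: near_C2S (near_C2I t1 (near_C2I (analytic_neq0 g1a g10) (analytic_neq0 g2a g20))).
  by move=> z [k [/eqP n1 /eqP n2]] /k[|[|]].
have Q0 : rcons P d != [::] by rewrite -size_eq0 size_rcons.
have nt := cross_nontrivial (cross_sym cx).
(* A cross equal to the total transform would both contain the exceptional curve and be contained in
   it. *)
have nc : needs_curvetta K (rcons P d).
  split=> // -[y [cy ty yt]]; apply: (exc_cross_set_not_sub cy (d := d)).
    apply: germ_sub_trans ty; apply: near_C2S t2 => z k e0.
    by apply: k; left.
  exact: germ_sub_trans yt te.
have lab : has_label K (rcons P d) x2 (Curvetta (rcons P d)).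
  exists (rcons P d), x2; split.
  - apply: curve_curvetta => //.
      by case: hx => ->; [right | left].
    move=> H; apply: nt.
    apply: near_C2S (near_C2I H (near_C2I te (cross_injective0 cx))).
    move=> z [k1 [k2 k3]] hz; apply: k3 (hz); apply: k2.
    by apply: contracted_sub_total Q0 _; exact: k1.
  - exact: prefix_refl.
  - by apply: near_C2W => z; rewrite /preimage /= proj_id.
  - by move=> H; apply: nt; apply: near_C2S H => z k /k; rewrite /= proj_id.
exists (exc_eq d, x2), (Lateral P), (Curvetta (rcons P d)),
  (p1.1 + p2.1 + 1, p1.2 + p2.2)%N, (0, 0)%N; split.
- exact: frame_curvetta hf s1 s2 g10 g20 cx lab (@curve_pair_curvetta _).
- exact: germ_eq_sym.
- exact: germ_eq_refl.
Qed.

Lemma framed_points P : P \in points K -> framed P (branches K P).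
Proof.
elim/last_ind: P => [|P d IH] hQ; first exact: framed_origin.
have hP := IH (points_rcons hQ).
have E := surjective_pairing (branches K (rcons P d)).
case: (exc_branch (branchesP hQ) (exc_sub_cross hQ)) => -[xe cx].
  by rewrite E; apply: (framed_step hQ _ xe cx hP); left.
by rewrite E; apply: framed_sym; apply: (framed_step hQ _ xe cx hP); right.
Qed.

End Invariants.

(** * The algorithm *)

Section Algorithm.
Variables (R : realType) (K : constellation R) (w : fgerm R).
Hypotheses (w_analytic : analytic w) (w_neq0 : w 0 != 0).
Implicit Types (P Q : inf_near R) (v : label R) (t : assignment R).
Implicit Types (ps : seq (inf_near R)).

(** The curve E_Q first appears at some [rcons Q d]; if this is a prefix of P, then Q is strictly
    below P, hence not maximal and so active. *)
Lemma has_label_vertex P h v : P \in points K -> has_label K P h v ->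
  base_vertex K v \/
  exists Q, [/\ v = Lateral Q, Q \in active K, prefix Q P & Q != P].
Proof.
move=> hP [Q [g [c QP _ _]]]; have := curve_germ_inv c.
case: v {c} => [_|_|Q1 [EQ nc _ _]|Q1 [d EQ _]]; [by left | by left | |].
  by left; rewrite /= -EQ.
right; exists Q1; rewrite EQ in QP.
have Q1P : prefix Q1 P by exact: prefix_trans (prefix_rcons _ _) QP.
have neQ : Q1 != P.
  apply/eqP => E; have := size_prefix QP.
  by rewrite E size_rcons ltnn.
split; [by [] | | exact: Q1P | exact: neQ].
exact: active_nonmax (points_closed hP Q1P) hP Q1P neQ.
Qed.

Lemma has_label_germ P h v : has_label K P h v -> exists Q g, curve_germ K v Q g.
Proof. by move=> [Q [g [c _ _ _]]]; exists Q, g. Qed.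

Lemma dual_segmentP P : P \in points K -> exists b p q,
  [/\ dual_segment K P b, forall b', dual_segment K P b' -> b = b',
      curve_pair K w b.1 p, curve_pair K w b.2 q &
      curve_pair K w (Lateral P) (p.1 + q.1, p.2 + q.2)%N].
Proof.
move=> /(framed_points w_analytic w_neq0)[u [v1 [v2 [p1 [p2 [hf e1 e2]]]]]].
have hl := frame_lateral hf; have [_ l1 l2 [q1 q2] _] := hf.
have d1 := has_label_germ_eq e1 l1; have d2 := has_label_germ_eq e2 l2.
exists (v1, v2), (p1.1.+1, p1.2), (p2.1.+1, p2.2); split.
- by split; [exact: d1 | exact: d2].
- move=> [v1' v2'] [/= d1' d2'].
  by rewrite (has_label_unique d1 d1') (has_label_unique d2 d2').
- exact: q1.
- exact: q2.
(* The one contributed by the Jacobian and the one in the log-discrepancy of E_P match those in the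
   two log-discrepancies that are added. *)
- by move: hl; rewrite addn1 /= addSn addnS.
Qed.

(** Invariant of the algorithm: values already assigned are correct, and they are assigned at least
    to the base vertices and to the lateral vertices treated so far. *)
Lemma run_sound ps t : run K ps t ->
  [/\ forall v p, t v = Some p -> curve_pair K w v p,
      forall v, base_vertex K v -> exists p, t v = Some p &
      forall P, P \in ps -> exists p, t (Lateral P) = Some p].
Proof.
elim=> {ps t} [t [t1 tb tn]|ps P b p q t t' _ [IHp IHb IHl] [[Pact ds] _] tp tq tP tv].
  split=> // [v p|v bv].
    have [bv|nb] := pselect (base_vertex K v); last by rewrite tn.
    have [->|nI] := pselect (v = Initial).
      by rewrite t1 => -[<-]; exact: curve_pair_initial.
    by rewrite tb // => -[<-]; exact: curve_pair_base.
  have [->|nI] := pselect (v = Initial); first by exists (1, 1)%N.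
  by exists (1, 0)%N; exact: tb.
split.
- move=> v r; have [->|nv] := pselect (v = Lateral P); last by rewrite tv //; exact: IHp.
  rewrite tP => -[<-].
  have [b0 [p0 [q0 [_ hu c1 c2 cl]]]] := dual_segmentP (active_sub Pact).
  have Eb := hu _ ds; rewrite Eb in c1 c2; have [l1 l2] := ds.
  have [Q1 [g1 cg1]] := has_label_germ l1; have [Q2 [g2 cg2]] := has_label_germ l2.
  (* The values read by the algorithm are those of the geometric computation, because a curve
     represented by a germ has only one pair. *)
  by rewrite (curve_pair_unique cg1 (IHp _ _ tp) c1) (curve_pair_unique cg2 (IHp _ _ tq) c2).
- move=> v bv; rewrite tv; first exact: IHb.
  by move=> E; rewrite E in bv.
- move=> Q; have [->|nQ] := eqVneq Q P; first by move=> _; eexists; exact: tP.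
  rewrite mem_rcons inE (negPf nQ) /= => /IHl; rewrite tv //.
  by case=> E; rewrite E eqxx in nQ.
Qed.

Lemma initial_assignment_exists : exists t, initial_assignment K t.
Proof.
exists (fun v => if v is Initial then Some (1, 1)%N else
  if pselect (base_vertex K v) then Some (1, 0)%N else None).
split=> // v; first by move=> bv nI; case: v bv nI => // [|Q] bv _; case: pselect.
case: v => [nb|nb|Q nb|Q nb]; first by case: nb.
all: by case: pselect.
Qed.

(** Stated for initial segments, to allow induction on the last point treated while remembering that
    the whole list exhausts the active points. *)
Lemma run_exists ps ps' : increasing_listing K (ps ++ ps') -> exists t, run K ps t.
Proof.
elim/last_ind: ps ps' => [|ps P IH] ps' H.
  by have [t ht] := initial_assignment_exists; exists t; exact: run_start.
rewrite cat_rcons in H; have [t rt] := IH _ H; have [_ mem pw] := H.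
have Pact : P \in active K by rewrite -mem mem_cat mem_head orbT.
have hP := active_sub Pact; have [_ tb tl] := run_sound rt.
have [b [p0 [q0 [ds hu _ _ _]]]] := dual_segmentP hP; have [l1 l2] := ds.
(* An active point strictly below P has already been treated, since the listing cannot place it
   after P. *)
have tS v h : has_label K P h v -> exists p, t v = Some p.
  case/(has_label_vertex hP) => [/tb //|[Q [-> Qact QP QneP]]]; apply: tl.
  move: pw; rewrite pairwise_cat pairwise_cons => /and3P[_ _ /andP[/allP nQ _]].
  move: Qact; rewrite -mem mem_cat inE (negPf QneP) /=.
  by case/orP => // /nQ; rewrite QP.
have [p tp] := tS _ _ l1; have [q tq] := tS _ _ l2.
exists (fun v => if pselect (v = Lateral P) then Some (p.1 + q.1, p.2 + q.2)%N else t v).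
apply: run_step rt _ tp tq _ _.
- by split; [split | move=> b' [_ /hu]].
- by case: pselect.
- by move=> v nv; case: pselect.
Qed.

(** The germ is needed because [curve_pair] quantifies over the germs representing a vertex: without
    one, every pair would satisfy it. *)
Lemma lotus_vertexP s v : lotus K s -> s v ->
  (exists Q h, curve_germ K v Q h) /\
  (base_vertex K v \/ exists2 P, v = Lateral P & P \in active K).
Proof.
have lab P h u : P \in points K -> has_label K P h u ->
    (exists Q h, curve_germ K u Q h) /\
    (base_vertex K u \/ exists2 P, u = Lateral P & P \in active K).
  move=> hP hl; split; first exact: has_label_germ hl.
  case: (has_label_vertex hP hl) => [bu|[Q [-> Qact _ _]]]; first by left.
  by right; exists Q.
elim=> {s} [b [l1 l2] [->|->]|P b [Pact [l1 l2]]|Q b [hQ _ _] [l1 l2] [->|->]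
  |s s' _ IH ss' _ /ss' /IH //].
- exact: lab (origin_in K) l1.
- exact: lab (origin_in K) l2.
- have hP := active_sub Pact; case=> [[->|->]|->].
  + exact: lab hP l1.
  + exact: lab hP l2.
  + split; last by right; exists P.
    by do 2 eexists; exact: (curve_lateral K P None).
- exact: lab hQ l1.
- exact: lab hQ l2.
Qed.

End Algorithm.

Theorem corollary7p9 (R : realType) (K : constellation R) (w : fgerm R)
    (w_analytic : analytic w) (w_neq0 : w 0 != 0)
    (ps : seq (inf_near R)) (ps_incr : increasing_listing K ps) :
  (exists t : assignment R, run K ps t) /\
  (forall t : assignment R, run K ps t ->
     forall v : label R, lotus_vertex K v ->
       exists2 p : nat * nat,
         t v = Some p & forall q, curve_pair K w v q <-> q = p).
Proof.
split; first by apply: (run_exists w_analytic w_neq0 (ps' := [::])); rewrite cats0.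
move=> t rt v /lotus_vertexP/(_ erefl)[[Q [h c]] vv].
have [sound tb tl] := run_sound w_analytic w_neq0 rt.
have [p tp] : exists p, t v = Some p.
  case: vv => [/tb //|[P -> Pact]]; apply: tl.
  by have [_ -> _] := ps_incr.
exists p; first exact: tp.
move=> q; split=> [hq|->]; last exact: sound tp.
exact: curve_pair_unique c hq (sound _ _ tp).
Qed.
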